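(* Let $p$ be a prime with $p\equiv 3\bmod 4$. Let $A,B\subset\mathbb{F}_p^2$ be sets with $|A|,|B|\ge p$. Then for almost every $g\in SO(2)$ there are at least $\gg p^2$ elements $z\in\mathbb{F}_p^2$ satisfying $$|A\cap(g(B)+z)|\ge 1.$$
   Context: $\mathbb{F}_p$ is the prime field with $p$ elements. $SO(2)$ is the group of $2\times 2$ orthogonal matrices over $\mathbb{F}_p$ with determinant $1$ (orthogonal: preserving $\|x\|=x_1^2+x_2^2$). $g(B)+z=\{gb+z:b\in B\}$. ''For almost every $g\in SO(2)$ property $X(g)$ holds'' means: there is an absolute constant $c>0$, independent of $p$ and the sets under consideration, such that $X(g)$ holds for at least $c|SO(2)|$ elements $g\in SO(2)$. $X\gg Y$ means $Y\le CX$ for an absolute constant $C>0$. *)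

(* Defs.v *)
From mathcomp Require Import all_boot all_order all_algebra.

Set Implicit Arguments.
Unset Strict Implicit.
Unset Printing Implicit Defensive.

Import GRing.Theory Num.Theory.
Local Open Scope ring_scope.

(* The paper's ‖x‖ : a quadratic form, with no square root. *)
Definition qnorm (p : nat) (x : 'cV['F_p]_2) : 'F_p :=
  x 0 0 ^+ 2 + x 1 0 ^+ 2.

Definition orthogonal (p : nat) (g : 'M['F_p]_2) : bool :=
  [forall x : 'cV['F_p]_2, qnorm (g *m x) == qnorm x].

Definition SO2 (p : nat) : {set 'M['F_p]_2} :=
  [set g : 'M['F_p]_2 | orthogonal g && (\det g == 1)].

Definition rigid_image (p : nat) (g : 'M['F_p]_2) (z : 'cV['F_p]_2)
    (B : {set 'cV['F_p]_2}) : {set 'cV['F_p]_2} :=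
  [set g *m b + z | b in B].

(* The proportion c is a parameter so that a statement can quantify it before
   p and the sets, making it an absolute constant. *)
Definition for_almost_every (R : numDomainType) (c : R) (p : nat)
    (X : pred 'M['F_p]_2) : Prop :=
  c * #|SO2 p|%:R <= #|[set g in SO2 p | X g]|%:R.

(* Main.v *)
Require Import Defs.
From HB Require Import structures.
From mathcomp Require Import all_boot all_order all_algebra all_field.
From mathcomp Require Import reals.
From mathcomp Require Import ring zify.
From Stdlib Require Import Classical.

(** The proof is by the polynomial method. One may assume that |A| = |B| = p.
    Write the plane as the quadratic extension of the prime field by a square
    root of -1, so that rotations become multiplications by elements u of norm
    one. The translation z with a = u b + z is a - u b. For fixed (a, b) the points (u, z)
    form a line of the three-dimensional space of rigid motions; in the
    coordinates (u, z, u * conj z) it is a line with coordinates affine in u,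
    namely (a - b u, conj a u - conj b), where conj is the Frobenius map. The
    theorem says that the p ^ 2 lines so obtained have a union of size of order
    p ^ 3, also when u is restricted to half of the rotations
    ([sweep_lower_bound]). A union of p ^ 2 lines can be smaller if many of them
    lie in a plane; the product structure prevents this ([parallel_lines]).

    If the union were small, a nonzero polynomial F of degree at most a small
    multiple of p would vanish on it ([interpolation]), hence on all the lines. As
    iterated polynomial rings over a field are factorial ([factorial_poly]), F may
    be replaced by a prime factor, which vanishes on more than 20 p f of the lines
    if f is the sum of its partial degrees ([rich_prime_factor]). The section of
    the surface F = 0 over a rotation u has at most p f points ([slice_zeros]), so
    most lines meet, in most of their points, at least two other lines of the
    surface. At such a point the section is singular or has an inflection
    ([three_lines_hessian]), so the Hessian polynomial of F, of degree at most
    3 f, vanishes along most of the lines. These are far more than the 6 f ^ 2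
    lines that two surfaces of degrees f and 3 f without common component can
    share ([bezout_bound]); hence F divides its Hessian.

    Over the field of rational functions of u, the curve F = 0 then has nothing
    but inflections. Since its degree is less than the characteristic, it is a
    line ([inflection_curve_is_line]). All lines of the surface are points of that
    line, and there are at most p such, by the product structure again. But
    20 p f is more than p.

    The hypothesis that p is 3 modulo 4 enters in the translation to complex
    numbers: it makes conj the Frobenius map and the norm anisotropic. *)

Set Implicit Arguments.
Unset Strict Implicit.
Unset Printing Implicit Defensive.

Import GRing.Theory Num.Theory.
Local Open Scope ring_scope.

(** * Factorization into primes in iterated polynomial rings *)

Definition divides (R : comNzRingType) (x y : R) : Prop :=
  exists q, y = q * x.

(** Units satisfy this, and zero does in a domain; so a factorization into such
    elements needs no separate unit factor. *)
Definition prime_or_unit (R : comNzRingType) (x : R) : Prop :=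
  forall a b, divides x (a * b) -> divides x a \/ divides x b.

Definition factorial_ring (R : comNzRingType) : Prop :=
  forall x : R, x != 0 ->
    exists2 s : seq R, (forall y, y \in s -> prime_or_unit y)
                     & x = \prod_(y <- s) y.

Section Divides.
Variable R : comNzRingType.
Implicit Types x y z : R.

Lemma divides_refl x : divides x x.
Proof. by exists 1; rewrite mul1r. Qed.

Lemma divides_mull x y z : divides x y -> divides x (z * y).
Proof. by case=> q ->; exists (z * q); rewrite mulrA. Qed.

Lemma divides_mulr x y z : divides x y -> divides x (y * z).
Proof. by rewrite mulrC; apply: divides_mull. Qed.

Lemma divides_add x y z : divides x y -> divides x z -> divides x (y + z).
Proof. by case=> a -> [b ->]; exists (a + b); rewrite mulrDl. Qed.

Lemma divides_sub x y z : divides x y -> divides x z -> divides x (y - z).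
Proof. by case=> a -> [b ->]; exists (a - b); rewrite mulrBl. Qed.

Lemma divides0 x : divides x 0.
Proof. by exists 0; rewrite mul0r. Qed.

End Divides.

Lemma field_factorial (F : fieldType) : factorial_ring F.
Proof.
move=> x x0; exists [:: x]; last by rewrite big_seq1.
move=> y; rewrite inE => /eqP -> a b _; left.
by exists (a / x); rewrite mulfVK.
Qed.

Section FactorialPoly.
Variable R : idomainType.

Lemma poly_split (F : {poly R}) :
  exists F' c, F = F' * 'X + c%:P /\ (size F' <= (size F).-1)%N.
Proof.
exists (\poly_(i < (size F).-1) F`_i.+1), F`_0; split; last exact: size_poly.
apply/polyP=> -[|i]; rewrite coefD coefMX coefC /= ?add0r // addr0 coef_poly.
case: ltnP => // h; rewrite nth_default //.
by move: h; case: (size F).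
Qed.

(** Gauss: modulo a prime [c] of the coefficient ring, the product of two
    polynomials can only vanish if one of them does; the constant terms are
    peeled off one at a time. *)
Lemma prime_or_unitC (c : R) : prime_or_unit c -> prime_or_unit c%:P.
Proof.
move=> pc a b.
elim: {a b}(size a + size b)%N {-2}a {-2}b (leqnn (size a + size b)) => [|n IH] a b.
  rewrite leqn0 addn_eq0 size_poly_eq0 => /andP[/eqP -> _] _.
  by left; apply: divides0.
have drop1 x y z : (x + y <= n.+1 -> z <= x.-1 -> 0 < x -> z + y <= n)%N by lia.
move=> hn; have [a0|a0] := eqVneq a 0; first by left; rewrite a0; apply: divides0.
have [b0|b0] := eqVneq b 0; first by right; rewrite b0; apply: divides0.
have [a' [a1 [ea sa]]] := poly_split a; have [b' [b1 [eb sb]]] := poly_split b.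
have sa0 : (0 < size a)%N by rewrite size_poly_gt0.
have sb0 : (0 < size b)%N by rewrite size_poly_gt0.
move=> dab; have [q eq] := dab.
have d0 : divides c (a1 * b1).
  exists q`_0; move/polyP/(_ 0%N): eq; rewrite ea eb coefMC => <-.
  by rewrite coef0M !coefD !coefMX !coefC /= !add0r.
have XI (d : {poly R}) : divides c%:P (d * 'X) -> divides c%:P d.
  case=> r er; exists (\poly_(i < size r) r`_i.+1).
  apply/polyP=> i; have /polyP/(_ i.+1) := er.
  rewrite coefMX /= !coefMC coef_poly => ->; case: ltnP => // h.
  by rewrite nth_default ?mul0r // (leq_trans h).
case: (pc _ _ d0) => -[r er].
  have : divides c%:P (a' * b * 'X).
    have -> : a' * b * 'X = a * b - (r%:P * b) * c%:P.
      by rewrite [in RHS]ea er rmorphM /=; ring.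
    by apply: divides_sub dab _; apply: divides_mull; apply: divides_refl.
  move/XI/IH; case; first exact: drop1 hn sa sa0.
    move=> da; left; rewrite ea er rmorphM; apply: divides_add.
      exact: divides_mulr.
    by apply: divides_mull; apply: divides_refl.
  by right.
have : divides c%:P (a * b' * 'X).
  have -> : a * b' * 'X = a * b - (r%:P * a) * c%:P.
    by rewrite [in RHS]eb er rmorphM /=; ring.
  by apply: divides_sub dab _; apply: divides_mull; apply: divides_refl.
move/XI/IH; case; first by rewrite addnC; apply: drop1 sb sb0; rewrite addnC.
  by left.
move=> da; right; rewrite eb er rmorphM; apply: divides_add.
  exact: divides_mulr.
by apply: divides_mull; apply: divides_refl.
Qed.

Hypothesis factR : factorial_ring R.

(** The prime factors of the denominator [d] of a factorization over the
    fraction field cancel one by one, each against [g] or against [h]. *)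
Lemma clear_denominator (d : R) (F g h : {poly R}) : d != 0 ->
  d%:P * F = g * h ->
  exists g' h', [/\ F = g' * h', size g' = size g & size h' = size h].
Proof.
move=> d0; have [s ps es] := factR d0.
move: ps d0; rewrite {d}es; elim: s g h => [|c s IH] g h ps.
  by rewrite big_nil mul1r => _ ->; exists g, h.
rewrite big_cons mulf_eq0 negb_or => /andP[c0 s0] e.
have c0' : c%:P != 0 :> {poly R} by rewrite polyC_eq0.
have ps' y : y \in s -> prime_or_unit y by move=> ys; apply: ps; rewrite inE ys orbT.
have sz (q : {poly R}) : size (q * c%:P) = size q.
  by rewrite mulrC mul_polyC size_scale.
have : divides c%:P (g * h).
  by rewrite -e rmorphM /= -mulrA mulrC; apply: divides_mull; apply: divides_refl.
have pc : prime_or_unit c by apply: ps; rewrite inE eqxx.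
case/(prime_or_unitC pc) => -[q eq].
  have /(IH _ _ ps' s0) [g' [h' [eF sg sh]]] : (\prod_(y <- s) y)%:P * F = q * h.
    apply: (mulfI c0'); rewrite mulrA -rmorphM e eq; ring.
  by exists g', h'; rewrite eq sz sg sh.
have /(IH _ _ ps' s0) [g' [h' [eF sg sh]]] : (\prod_(y <- s) y)%:P * F = g * q.
  apply: (mulfI c0'); rewrite mulrA -rmorphM e eq; ring.
by exists g', h'; rewrite eq sz sg sh.
Qed.

(** Stated through what primitivity is used for: passing from divisibility over
    the fraction field to divisibility. *)
Definition primitive_poly (F : {poly R}) : Prop :=
  forall (d : R) (X : {poly R}), d != 0 -> divides F (d%:P * X) -> divides F X.

(** Divide [F] by each prime factor of its leading coefficient that divides it;
    the primes that remain in the leading coefficient do not divide the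
    quotient, and no other prime can. *)
Lemma primitive_part (F : {poly R}) : F != 0 ->
  exists s F', [/\ forall y, y \in s -> prime_or_unit y,
    F = (\prod_(y <- s) y)%:P * F' & primitive_poly F'].
Proof.
move=> F0.
have [s ps es] : exists2 s : seq R, (forall y, y \in s -> prime_or_unit y) &
    lead_coef F = \prod_(y <- s) y by apply: factR; rewrite lead_coef_eq0.
(* s1: the primes divided out; s2: those left in the leading coefficient *)
have [s1 [s2 [F' [ps1 ps2 eF eL nd]]]] : exists s1 s2 F',
  [/\ forall y, y \in s1 -> prime_or_unit y,
      forall y, y \in s2 -> prime_or_unit y,
      F = (\prod_(y <- s1) y)%:P * F',
      lead_coef F' = \prod_(y <- s2) y &
      forall y, y \in s2 -> ~ divides y%:P F'].
  have : exists s1 s2 s3 F', [/\ s3 = [::], forall y, y \in s1 -> prime_or_unit y,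
      forall y, y \in s2 ++ s3 -> prime_or_unit y,
      F = (\prod_(y <- s1) y)%:P * F' & 
      lead_coef F' = \prod_(y <- s2 ++ s3) y /\
      forall y, y \in s2 -> ~ divides y%:P F'].
    have : exists s1 s2 s3 F', [/\ s3 = s, forall y, y \in s1 -> prime_or_unit y,
      forall y, y \in s2 ++ s3 -> prime_or_unit y,
      F = (\prod_(y <- s1) y)%:P * F' & 
      lead_coef F' = \prod_(y <- s2 ++ s3) y /\
      forall y, y \in s2 -> ~ divides y%:P F'].
      by exists [::], [::], s, F; split; rewrite // big_nil mul1r.
    elim: s {ps es} => // c s IH [s1 [s2 [s3 [F' [-> ps1 ps2 eF [eL nd]]]]]].
    have pc : prime_or_unit c by apply: ps2; rewrite mem_cat inE eqxx orbT.
    apply: IH; case: (classic (divides c%:P F')) => [[q eq]|ndc].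
      have c0 : c != 0.
        by apply: contra_neq F0 => c0; rewrite eF eq c0 mulr0 mulr0.
      exists (c :: s1), s2, s, q; split => //.
      - by move=> y; rewrite inE => /orP[/eqP -> //|/ps1].
      - by move=> y; rewrite mem_cat => h; apply: ps2; rewrite mem_cat inE;
          case/orP: h => ->; rewrite ?orbT.
      - by rewrite big_cons eF eq rmorphM /=; ring.
      split=> [|y /nd h [r er]]; last first.
        by apply: h; exists (r * c%:P); rewrite eq er; ring.
      apply: (mulfI c0); move: eL; rewrite eq lead_coefM lead_coefC mulrC => ->.
      by rewrite !big_cat big_cons /=; ring.
    exists s1, (c :: s2), s, F'; split => //.
    - move=> y h; apply: ps2; move: h; rewrite !(mem_cat, inE).
      by case/orP=> [/orP[]|] ->; rewrite ?orbT.
    - split; first by rewrite eL cat_cons big_cons !big_cat big_cons /=; ring.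
      by move=> y; rewrite inE => /orP[/eqP -> //|/nd].
  case=> [t1 [t2 [_ [F' [-> q1 q2 q3 [q4 q5]]]]]]; rewrite cats0 in q2 q4.
  by exists t1, t2, F'.
exists s1, F'; split=> // d X d0.
have [t pt et] := factR d0; move: d0; rewrite {d}et.
elim: t X pt => [|c t IH] X pt; first by rewrite big_nil mul1r.
rewrite big_cons mulf_eq0 negb_or => /andP[c0 t0] [Y eY].
have c0' : c%:P != 0 :> {poly R} by rewrite polyC_eq0.
have pt' y : y \in t -> prime_or_unit y by move=> ys; apply: pt; rewrite inE ys orbT.
have pc : prime_or_unit c by apply: pt; rewrite inE eqxx.
(* c does not divide F': it would divide the leading coefficient, hence be
   associate to one of the primes of s2 *)
suff [Z eZ] : divides c%:P Y.
  apply: IH => //; exists Z; apply: (mulfI c0').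
  by rewrite mulrA -rmorphM eY eZ; ring.
have : divides c%:P (Y * F').
  by rewrite -eY rmorphM /= -mulrA mulrC; apply: divides_mull; apply: divides_refl.
case/(prime_or_unitC pc) => // -[q eq].
have : divides c (\prod_(y <- s2) y).
  by exists (lead_coef q); rewrite -eL eq lead_coefM lead_coefC.
have L0 : \prod_(y <- s2) y != 0.
  by rewrite -eL lead_coef_eq0; apply: contra_neq F0 => z; rewrite eF z mulr0.
suff key s3 : {subset s3 <= s2} -> \prod_(y <- s3) y != 0 ->
    divides c (\prod_(y <- s3) y) -> divides c%:P Y by exact: key.
elim: s3 => [|y s3 IH3] sub {}L0.
  rewrite big_nil => -[r er].
  by exists (Y * r%:P); rewrite -mulrA -rmorphM /= -er mulr1.
rewrite big_cons mulf_eq0 negb_or in L0; case/andP: L0 => y0 L0.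
have ys2 : y \in s2 by apply: sub; rewrite inE eqxx.
rewrite big_cons; case/pc => [[r er]|]; last first.
  by apply: IH3 => // z zs; apply: sub; rewrite inE zs orbT.
have : divides y (r * c) by rewrite -er; apply: divides_refl.
case/(ps2 _ ys2) => -[w ew].
  exists (Y * w%:P); rewrite -mulrA -rmorphM /=.
  suff -> : w * c = 1 by rewrite mulr1.
  by apply: (mulIf y0); rewrite mul1r [RHS]er ew; ring.
by case: (nd _ ys2); exists (q * w%:P); rewrite eq ew rmorphM /=; ring.
Qed.

(** A primitive polynomial that does not split over the fraction field is
    prime, by Bezout's identity over that field. *)
Lemma irreducible_primitive_prime (F : {poly R}) : (1 < size F)%N ->
  primitive_poly F ->
  (forall g h, F = g * h -> (size g <= 1)%N \/ (size h <= 1)%N) ->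
  prime_or_unit F.
Proof.
move=> sF prim irr a b dab.
have F0 : F != 0 by rewrite -size_poly_gt0 (leq_trans _ sF).
set g := gcdp F a.
have g0 : g != 0 by rewrite gcdp_eq0 negb_and F0.
have [sg|sg] := leqP (size g) 1.
  right.
  have [[u v] /= huv] := Pdiv.Idomain.Bezoutp F a.
  have /Pdiv.Idomain.eqpP[[c1 c2] /andP[/= c10 c20] ec] := huv.
  have [e e0 eg] : exists2 e, e != 0 & g = e%:P.
    have /size1_polyC eg := sg; exists g`_0; last exact: eg.
    by rewrite -polyC_eq0 -eg.
  have ee : (c2 * e)%:P * b = (c1%:P * u * b) * F + c1%:P * v * (a * b).
    rewrite rmorphM /= -eg mul_polyC -ec -mul_polyC; ring.
  apply: (prim (c2 * e)); first by rewrite mulf_neq0.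
  rewrite ee; apply: divides_add; first by apply: divides_mull; apply: divides_refl.
  exact: divides_mull.
left.
have /Pdiv.Idomain.dvdpP [[c h] /= c0 eh] := Pdiv.Idomain.dvdp_gcdl F a.
have /Pdiv.Idomain.dvdpP [[c' k] /= c'0 ek] := Pdiv.Idomain.dvdp_gcdr F a.
rewrite -/g -mul_polyC in eh; rewrite -/g -mul_polyC in ek.
have [g' [h' [eF sg' sh']]] := clear_denominator c0 eh.
have sh : (size h <= 1)%N.
  by case: (irr _ _ eF) => [|h1]; [rewrite sg' | rewrite sh' leqNgt sg in h1].
have h0 : h != 0.
  apply: contraTneq isT => h0; move: eh; rewrite h0 mul0r => /eqP.
  by rewrite mulf_eq0 polyC_eq0 (negPf c0) (negPf F0).
have eh0 := size1_polyC sh.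
have h00 : h`_0 != 0 by rewrite -polyC_eq0 -eh0.
apply: (prim (c' * h`_0)); first by rewrite mulf_neq0.
exists (k * c%:P).
by rewrite rmorphM /= -eh0 -[RHS]mulrA eh [LHS]mulrAC ek; ring.
Qed.

(** Gauss's theorem. The degree decreases as long as the polynomial splits; one
    that does not is its content times a primitive prime. *)
Theorem factorial_poly : factorial_ring {poly R}.
Proof.
have prodC (s : seq R) : (forall y, y \in s -> prime_or_unit y) ->
    exists2 t : seq {poly R}, (forall y, y \in t -> prime_or_unit y) &
      (\prod_(y <- s) y)%:P = \prod_(y <- t) y.
  move=> ps; exists [seq y%:P | y <- s].
    by move=> _ /mapP[y ys ->]; apply/prime_or_unitC/ps.
  by rewrite big_map rmorph_prod.
move=> F; elim: {F}(size F) {-2}F (leqnn (size F)) => [|n IH] F.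
  by rewrite leqn0 size_poly_eq0 => /eqP ->; rewrite eqxx.
move=> sF F0; have [s1|s1] := leqP (size F) 1.
  have eF := size1_polyC s1.
  have F00 : F`_0 != 0 by rewrite -polyC_eq0 -eF.
  have [s ps es] := factR F00; have [t pt et] := prodC s ps.
  by exists t; rewrite // eF es.
case: (classic (exists g h : {poly R}, [/\ F = g * h, (1 < size g)%N & (1 < size h)%N])).
  case=> g [h [eF sg sh]].
  move: F0 (sF); rewrite eF mulf_eq0 negb_or => /andP[g0 h0].
  rewrite size_mul // => sn.
  have arith x y : (1 < y -> (x + y).-1 <= n.+1 -> x <= n)%N by lia.
  have [||s ps ->] := IH g; [exact: arith sh sn|by []|].
  have [||t pt ->] := IH h; [by rewrite addnC in sn; apply: arith sg sn|by []|].
  exists (s ++ t); last by rewrite big_cat.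
  by move=> y; rewrite mem_cat => /orP[/ps|/pt].
move=> irr; have [s [F' [ps eF prim]]] := primitive_part F0.
have [t pt et] := prodC s ps.
have /andP[d0 F'0] : (\prod_(y <- s) y != 0) && (F' != 0).
  by move: F0; rewrite eF mulf_eq0 negb_or polyC_eq0.
have pF' : prime_or_unit F'.
  apply: irreducible_primitive_prime => //.
    by move: s1; rewrite eF mul_polyC size_scale.
  move=> g h eg; apply: NNPP => /not_or_and[/negP g1 /negP h1].
  apply: irr; exists ((\prod_(y <- s) y)%:P * g), h.
  rewrite eF eg mulrA mul_polyC size_scale //.
  by rewrite !ltnNge.
exists (rcons t F').
  by move=> y; rewrite mem_rcons inE => /orP[/eqP ->|/pt].
by rewrite -cats1 big_cat big_seq1 eF et.
Qed.

End FactorialPoly.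

(** * Common zeros of two bivariate polynomials *)

Section DegreeBounds.
Variable R : nzRingType.
Implicit Types p q : {poly R}.

Lemma sizeM_leS p q a b : (size p <= a.+1)%N -> (size q <= b.+1)%N ->
  (size (p * q)%R <= (a + b).+1)%N.
Proof.
have arith x y z : (z <= (x + y).-1 -> x <= a.+1 -> y <= b.+1 -> z <= (a + b).+1)%N by lia.
by move=> hp hq; apply: arith (size_polyMleq _ _) hp hq.
Qed.

Lemma sizeD_le p q a : (size p <= a)%N -> (size q <= a)%N -> (size (p + q)%R <= a)%N.
Proof. by move=> hp hq; rewrite (leq_trans (size_polyD _ _)) // geq_max hp. Qed.

Lemma sizeB_le p q a : (size p <= a)%N -> (size q <= a)%N -> (size (p - q)%R <= a)%N.
Proof. by move=> hp hq; rewrite sizeD_le // size_polyN. Qed.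

Lemma size_sum_le (I : Type) (r : seq I) (P : pred I) (F : I -> {poly R}) a :
  (forall i, P i -> (size (F i) <= a)%N) ->
  (size (\sum_(i <- r | P i) F i)%R <= a)%N.
Proof.
move=> h; apply: (big_ind (fun p : {poly R} => (size p <= a)%N)) => //.
  by rewrite size_poly0.
by move=> p q; apply: sizeD_le.
Qed.

Lemma sizeX_leS p a n : (size p <= a.+1)%N -> (size (p ^+ n)%R <= (a * n).+1)%N.
Proof.
move=> hp; elim: n => [|n IH]; first by rewrite expr0 muln0 size_poly1.
by rewrite exprS mulnS; apply: sizeM_leS.
Qed.

End DegreeBounds.

Lemma size_det_leS (R : comNzRingType) n (M : 'M[{poly R}]_n) (r : 'I_n -> nat) :
  (forall i j, (size (M i j) <= (r i).+1)%N) ->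
  (size (\det M) <= (\sum_i r i).+1)%N.
Proof.
move=> hM; apply: size_sum_le => s _; rewrite size_Msign.
elim/big_rec2: _ => [|i a p _ h]; first by rewrite size_poly1.
exact: sizeM_leS.
Qed.

(** The Sylvester matrix has one row of coefficients of each polynomial for each
    degree of the other. *)
Lemma size_resultant_leS (R : comNzRingType) (p q : {poly {poly R}}) :
  (size (resultant p q) <=
     ((size q).-1 * (sizeY p).-1 + (size p).-1 * (sizeY q).-1).+1)%N.
Proof.
pose r (i : 'I_((size q).-1 + (size p).-1)) :=
  match split i with inl _ => (sizeY p).-1 | inr _ => (sizeY q).-1 end.
have -> : ((size q).-1 * (sizeY p).-1 + (size p).-1 * (sizeY q).-1 = \sum_i r i)%N.
  rewrite big_split_ord /= /r; congr addn.
    rewrite (eq_bigr (fun=> (sizeY p).-1)) ?sum_nat_const ?card_ord // => i _.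
    by rewrite (unsplitK (inl i)).
  rewrite (eq_bigr (fun=> (sizeY q).-1)) ?sum_nat_const ?card_ord // => i _.
  by rewrite (unsplitK (inr i)).
apply: size_det_leS => i j; rewrite Sylvester_mxE /r.
have h (u : {poly {poly R}}) k : (size (u`_k)%R <= (sizeY u).-1.+1)%N.
  by apply: leq_trans (max_size_coefXY u k) (leqSpred _).
by case: (split i) => k; case: (k <= j)%N; rewrite ?mulr1n ?mulr0n ?size_poly0 /= ?h.
Qed.

Lemma not_divides_small (R : idomainType) (F X : {poly R}) :
  X != 0 -> (size X < size F)%N -> ~ divides F X.
Proof.
move=> X0 sX [q eX]; move: X0 sX; rewrite eX mulf_eq0 negb_or => /andP[q0 F0].
rewrite size_mul // ltnNge => /negP; apply.
have : (0 < size q)%N by rewrite size_poly_gt0.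
by case: (size q) => // k _; rewrite addSn /= leq_addl.
Qed.

Section Bezout.
Variable R : idomainType.

(** A weak form of Bezout's theorem: points with distinct first coordinates on
    two curves without common component are roots of the resultant. *)
Lemma bezout_bound (F Q : {poly {poly R}}) (s : seq (R * R)) :
  prime_or_unit F -> (1 < size F)%N -> ~ divides F Q ->
  uniq [seq x.1 | x <- s] ->
  (forall x, x \in s -> F.[x.2, x.1] = 0) ->
  (forall x, x \in s -> Q.[x.2, x.1] = 0) ->
  (size s <= (size Q).-1 * (sizeY F).-1 + (size F).-1 * (sizeY Q).-1)%N.
Proof.
move=> pF sF nd us sF0 sQ0.
have F0 : F != 0 by rewrite -size_poly_gt0 (leq_trans _ sF).
have Q0 : Q != 0 by apply: contra_notN nd => /eqP ->; apply: divides0.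
have count (r : {poly R}) m : r != 0 -> (size r <= m.+1)%N ->
    (forall x, x \in s -> root r x.1) -> (size s <= m)%N.
  move=> r0 sr hr; rewrite -ltnS; apply: leq_trans sr.
  rewrite -(size_map fst); apply: max_poly_roots => //.
  by apply/allP => _ /mapP[x xs ->]; apply: hr.
have [sQ|sQ] := leqP (size Q) 1.
  have eQ := size1_polyC sQ.
  apply: (count Q`_0); first by rewrite -polyC_eq0 -eQ.
    apply: leq_trans (max_size_coefXY _ _) _.
    have : (0 < (size F).-1)%N by lia.
    by case: ((size F).-1) => // m _; nia.
  by move=> x xs; apply/rootP; have := sQ0 x xs; rewrite {1}eQ hornerC.
have [[u v] [/= _ _] e] := resultant_in_ideal sF sQ.
apply: (count (resultant F Q)); last first.
- move=> x xs; apply/rootP.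
  have -> : (resultant F Q).[x.1] = (resultant F Q)%:P.[x.2, x.1] by rewrite hornerC.
  by rewrite e hornerD !hornerM hornerD !hornerM sF0 // sQ0 // !mulr0 addr0.
- exact: size_resultant_leS.
(* a common factor would be a multiple of the prime F *)
rewrite resultant_eq0 -leqNgt leqNgt; apply/negP => sg; case: nd.
set g := gcdp F Q in sg.
have /Pdiv.Idomain.dvdpP [[c h] /= c0 eh] := Pdiv.Idomain.dvdp_gcdl F Q.
have /Pdiv.Idomain.dvdpP [[c' k] /= c'0 ek] := Pdiv.Idomain.dvdp_gcdr F Q.
rewrite -/g -mul_polyC in eh; rewrite -/g -mul_polyC in ek.
have cF0 : c%:P * F != 0 by rewrite mulf_neq0 // polyC_eq0.
have /andP[h0 g0] : (h != 0) && (g != 0) by rewrite -negb_or -mulf_eq0 -eh.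
have /pF [] : divides F (h * g) by exists c%:P.
  move=> /(not_divides_small h0) [].
  have /(congr1 (fun X : {poly {poly R}} => size X)) := eh.
  rewrite mul_polyC size_scale // size_mul // => ->.
  have : (0 < size h)%N by rewrite size_poly_gt0.
  by move: sg; case: (size g) => [|[|m]] //; case: (size h) => // n _ _; rewrite !addnS /= ltnS leq_addr.
case=> q eg.
have /pF [] : divides F (c'%:P * Q) by rewrite ek eg mulrA; apply: divides_mull; apply: divides_refl.
  move=> /not_divides_small []; rewrite ?polyC_eq0 //.
  by rewrite size_polyC c'0.
by [].
Qed.

End Bezout.

(** * Curves all of whose points are inflections *)

Lemma rmorph_horner2 (S S' : nzRingType) (phi : {rmorphism S -> S'})
    (G : {poly {poly S}}) (w z : S) :
  phi G.[w, z] = (map_poly (map_poly phi) G).[phi w, phi z].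
Proof. by rewrite -horner_map /= -horner_map /= map_polyC. Qed.

Lemma map_poly_comp2 (R S S' : nzRingType) (f : {rmorphism R -> S})
    (g : {rmorphism S -> S'}) (G : {poly {poly R}}) :
  map_poly (map_poly g) (map_poly (map_poly f) G) = map_poly (map_poly (g \o f)) G.
Proof.
rewrite -map_poly_comp; apply: eq_map_poly => c /=.
by rewrite -map_poly_comp.
Qed.

Lemma horner2_XY (R : comNzRingType) (F : {poly {poly R}}) :
  (map_poly (map_poly (polyC \o polyC)) F).['X, 'X%:P] = F.
Proof.
elim/poly_ind: F => [|P c IH]; first by rewrite map_poly0 !horner0.
rewrite rmorphD rmorphM /= map_polyX map_polyC /= !(hornerD, hornerM, hornerC, hornerX) IH.
congr (_ + _).
rewrite map_poly_comp -[RHS]/(polyC c) -{2}[c]comp_polyXr /comp_poly.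
by rewrite -[in RHS]horner_map.
Qed.

Lemma size_horner_leS (S : comNzRingType) (G : {poly {poly S}}) (z : {poly S}) a b :
  (size z <= 2)%N -> (forall i, size (G`_i)%R <= a.+1)%N -> (size G <= b.+1)%N ->
  (size G.[z] <= (a + b).+1)%N.
Proof.
move=> hz ha hb; rewrite (horner_coef_wide _ hb); apply: size_sum_le => i _.
apply: leq_trans (sizeM_leS (ha i) (sizeX_leS i hz)) _.
by rewrite mul1n ltnS leq_add2l -ltnS ltn_ord.
Qed.

Lemma size_horner2_leS (S : comNzRingType) (G : {poly {poly {poly S}}})
    (w z : {poly S}) a b c :
  (size z <= 2)%N -> (size w <= 2)%N ->
  (forall j i, size (G`_j`_i)%R <= a.+1)%N ->
  (forall j, size (G`_j)%R <= b.+1)%N -> (size G <= c.+1)%N ->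
  (size G.[w, z] <= (a + b + c).+1)%N.
Proof.
move=> hz hw ha hb hc.
rewrite (horner_coef_wide _ hc) horner_sum; apply: size_sum_le => j _.
rewrite -rmorphXn /= hornerM hornerC.
apply: leq_trans (sizeM_leS (size_horner_leS hz (ha j) (hb j)) (sizeX_leS j hw)) _.
by rewrite mul1n ltnS leq_add2l -ltnS ltn_ord.
Qed.

Definition derivZ (R : nzRingType) (F : {poly {poly R}}) : {poly {poly R}} :=
  map_poly (@deriv R) F.

Fact derivZ_is_zmod_morphism (R : nzRingType) : zmod_morphism (@derivZ R).
Proof. by move=> F G; rewrite /derivZ raddfB. Qed.

HB.instance Definition _ (R : nzRingType) :=
  GRing.isZmodMorphism.Build {poly {poly R}} {poly {poly R}} (@derivZ R)
    (@derivZ_is_zmod_morphism R).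

Lemma map_poly_MXaddC (R S : nzRingType) (f : {additive R -> S}) p c :
  map_poly f (p * 'X + c%:P) = map_poly f p * 'X + (f c)%:P.
Proof.
apply/polyP=> i; rewrite coef_map !coefD !coefMX !coefC raddfD /= !coef_map.
by case: i => [|i] //=; rewrite raddf0.
Qed.

Lemma map_polyM_derivation (R : comNzRingType) (d : {additive R -> R}) :
  (forall x y, d (x * y) = d x * y + x * d y) ->
  forall p q, map_poly d (p * q) = map_poly d p * q + p * map_poly d q.
Proof.
move=> dM p q; apply/polyP=> i.
rewrite coefD !coef_map !coefM raddf_sum -big_split /=.
by apply: eq_bigr => j _; rewrite dM !coef_map.
Qed.

Lemma derivZM (R : comNzRingType) (F G : {poly {poly R}}) :
  derivZ (F * G) = derivZ F * G + F * derivZ G.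
Proof. exact: map_polyM_derivation (@derivM R) F G. Qed.

Section ChainRule.
Variables (R S : comNzRingType) (iota : {rmorphism R -> S}).
Variables (d : {additive R -> R}) (D : S -> S).
Hypothesis DD : forall x y, D (x + y) = D x + D y.
Hypothesis DM : forall x y, D (x * y) = D x * y + x * D y.
Hypothesis Diota : forall r, D (iota r) = iota (d r).

Let D0 : D 0 = 0.
Proof. by apply: (addrI (D 0)); rewrite -DD !addr0. Qed.

Lemma chain_rule1 (c : {poly R}) z :
  D (map_poly iota c).[z] =
    (map_poly iota (map_poly d c)).[z] + (map_poly iota c^`()).[z] * D z.
Proof.
elim/poly_ind: c => [|p c IH].
  by rewrite !raddf0 !horner0 D0 mul0r addr0.
rewrite !map_poly_MXaddC derivMXaddC !(rmorphD, rmorphM) /= ?map_polyX ?map_polyC /=.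
rewrite !(hornerD, hornerM, hornerC, hornerX) DD DM IH Diota. ring.
Qed.

Lemma chain_rule2 (F : {poly {poly R}}) w z :
  D (map_poly (map_poly iota) F).[w, z] =
    (map_poly (map_poly iota) (map_poly (map_poly d) F)).[w, z]
    + (map_poly (map_poly iota) (derivZ F)).[w, z] * D z
    + (map_poly (map_poly iota) F^`()).[w, z] * D w.
Proof.
elim/poly_ind: F => [|P c IH].
  by rewrite /derivZ !raddf0 !horner0 D0 !mul0r !addr0.
rewrite /derivZ !map_poly_MXaddC derivMXaddC !(rmorphD, rmorphM) /=.
rewrite ?map_polyX ?map_polyC /=.
rewrite !(hornerD, hornerM, hornerC, hornerX) DD DM IH /derivZ chain_rule1.
by ring.
Qed.

End ChainRule.

(** The Hessian form of [F] on the tangent vector [(F_W, - F_Z)]: its zeros on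
    the curve [F = 0] are the singular points and the inflections. The
    two mixed derivatives add up to the usual coefficient [2 F_ZW]. *)
Definition hessian (R : comNzRingType) (F : {poly {poly R}}) : {poly {poly R}} :=
  derivZ (derivZ F) * F^`() ^+ 2
  - (derivZ F^`() + (derivZ F)^`()) * derivZ F * F^`()
  + F^`()^`() * derivZ F ^+ 2.

Lemma rmorph_hessian (R S : comNzRingType) (ev : {rmorphism {poly {poly R}} -> S}) F :
  ev (hessian F) = ev (derivZ (derivZ F)) * ev F^`() ^+ 2
    - (ev (derivZ F^`()) + ev (derivZ F)^`()) * ev (derivZ F) * ev F^`()
    + ev F^`()^`() * ev (derivZ F) ^+ 2.
Proof. by rewrite /hessian !(rmorphD, rmorphN, rmorphM). Qed.

Section Tangent.
Variable R : idomainType.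
Notation T := {poly {poly R}}.
Variable F : T.

Let V1 : T := F^`().
Let V2 : T := - derivZ F.

Let iota : R -> {poly T} := polyC \o (polyC \o polyC).

(** [F (Z + X V1, W + X V2)]: the curve along the tangent line at its generic
    point [(Z, W)], with parameter [X]. *)
Definition tangent_motion : {poly T} :=
  (map_poly (map_poly (polyC \o (polyC \o polyC))) F).['X%:P + 'X * V2%:P, ('X%:P)%:P + 'X * V1%:P].

Lemma tangent_motion0 : tangent_motion`_0 = F.
Proof.
rewrite -horner_coef0 /tangent_motion.
rewrite -[LHS]/(horner_eval 0 _) rmorph_horner2 /= map_poly_comp2 /=.
have h0 (Y V : T) : horner_eval 0 (Y%:P + 'X * V%:P) = Y.
  by rewrite /horner_eval !(hornerD, hornerM, hornerC, hornerX) mul0r addr0.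
rewrite !h0.
rewrite -[RHS]horner2_XY; congr (_.[_, _]).
apply: eq_map_poly => c; apply: eq_map_poly => x /=.
by rewrite /horner_eval hornerC.
Qed.

Lemma size_tangent_motion :
  (size tangent_motion <= ((sizeY F).-1 + (size F).-1).+1)%N.
Proof.
have sX (Y V : T) : (size (Y%:P + 'X * V%:P)%R <= 2)%N.
  apply: sizeD_le; first by apply: leq_trans (size_polyC_leq1 _) _.
  by apply: (@sizeM_leS _ _ _ 1 0); rewrite ?size_polyX ?size_polyC_leq1.
rewrite -[((sizeY F).-1)%N]add0n; apply: size_horner2_leS; rewrite ?sX //.
- by move=> j i; rewrite !coef_map /= size_polyC_leq1.
- move=> j; rewrite coef_map /= (leq_trans (size_poly _ _)) //.
  by apply: leq_trans (max_size_coefXY _ _) (leqSpred _).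
- by rewrite (leq_trans (size_poly _ _)) // leqSpred.
Qed.

(* the derivation of the coordinate ring along the Hamiltonian field (V1, V2) *)
Let delta (G : T) : T := V1 * derivZ G + V2 * G^`().

Let deltaM G1 G2 : delta (G1 * G2) = delta G1 * G2 + G1 * delta G2.
Proof. by rewrite /delta derivZM derivM; ring. Qed.
Let deltaF : delta F = 0.
Proof. by rewrite /delta /V1 /V2; ring. Qed.

Let curvature : V1 * delta V2 - V2 * delta V1 = - hessian F.
Proof.
rewrite /delta /hessian /V1 /V2 /derivZ !raddfN /= -/(derivZ _); ring.
Qed.

Let delta_hat (G : {poly T}) : {poly T} :=
  V1%:P * map_poly (@derivZ R) G + V2%:P * map_poly (@deriv {poly R}) G.

(* the derivation V1 * delta - (V1 + X delta V1) d/dX kills Z + X V1 and sends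
   W + X V2 to X times the curvature, hence the motion to a multiple of F *)
Let DX (G : {poly T}) : {poly T} :=
  V1%:P * delta_hat G - (V1%:P + 'X * (delta V1)%:P) * G^`().

Let DXD G1 G2 : DX (G1 + G2) = DX G1 + DX G2.
Proof. by rewrite /DX /delta_hat /derivZ !raddfD /=; ring. Qed.

Let DXM G1 G2 : DX (G1 * G2) = DX G1 * G2 + G1 * DX G2.
Proof.
rewrite /DX /delta_hat (map_polyM_derivation (@derivZM R)).
by rewrite (map_polyM_derivation (@derivM {poly R})) derivM; ring.
Qed.

Let DXlin (Y V : T) : DX (Y%:P + 'X * V%:P) =
  V1%:P * ((delta Y)%:P + 'X * (delta V)%:P) - (V1%:P + 'X * (delta V1)%:P) * V%:P.
Proof.
rewrite /DX /delta_hat [Y%:P + _]addrC ['X * V%:P]mulrC !map_poly_MXaddC !map_polyC /=.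
rewrite derivMXaddC derivC mul0r addr0 /delta !(rmorphD, rmorphM) /=; ring.
Qed.

Hypothesis hess : divides F (hessian F).

Let DX_motion n : divides F (DX tangent_motion)`_n.
Proof.
pose zero : {additive R -> R} := \0.
have DXiota r : DX (iota r) = iota (zero r).
  rewrite /DX /delta_hat /= derivC !map_polyC /= derivC /derivZ map_polyC /= derivC.
  by rewrite !rmorph0 !mulr0 addr0 subr0 mulr0 /iota /= !polyC0.
rewrite /tangent_motion (chain_rule2 DXD DXM DXiota).
rewrite /zero; set Z0 := map_poly (map_poly zero) F.
have -> : map_poly (map_poly iota) Z0 = 0.
  by apply/polyP=> j; apply/polyP=> i; rewrite !coef_map !coef0 /= /iota /= !polyC0.
rewrite 2!horner0 add0r 2!DXlin.
have -> : delta 'X%:P = V1.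
  by rewrite /delta derivC /derivZ map_polyC /= derivX mulr1 mulr0 addr0.
have -> : delta 'X = V2.
  rewrite /delta derivX /derivZ mulr1.
  have -> : map_poly (@deriv R) 'X = 0.
    by apply/polyP=> i; rewrite coef_map coefX coef0; case: (i == _); rewrite /= ?derivC ?deriv0.
  by rewrite mulr0 add0r.
have key (S : comNzRingType) (P1 P2 v1 v2 d1 d2 x : S) :
    P1 * (v1 * (v1 + x * d1) - (v1 + x * d1) * v1)
      + P2 * (v1 * (v2 + x * d2) - (v1 + x * d1) * v2) = P2 * x * (v1 * d2 - v2 * d1).
  by ring.
rewrite key -!polyCM -polyCB curvature; set P2 := (X in X * 'X).
rewrite coefMC mulrN; case: hess => q ->.
by exists (- ((P2 * 'X)`_n * q)); ring.
Qed.

Hypotheses (pF : prime_or_unit F) (sF : (1 < size F)%N).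
Hypothesis nV1 : ~ divides F V1.
Variable m : nat.
Hypothesis char_m : forall n, (0 < n <= m)%N -> n%:R != 0 :> R.
Hypothesis size_m : (size tangent_motion <= m.+1)%N.

(** If all points of the curve are inflections, contact of order [n] of the
    generic tangent line forces contact of order [n + 1]: by the derivation above,
    modulo [F], the next coefficient times [n + 1] is a multiple of the derivative
    of the previous one. The characteristic must not divide [n + 1]. *)
Lemma tangent_motion_divides n : divides F tangent_motion`_n.
Proof.
elim: n => [|n IH]; first by rewrite tangent_motion0; apply: divides_refl.
have [nm|mn] := leqP n.+1 m; last first.
  by rewrite nth_default ?(leq_trans size_m) //; apply: divides0.
set Phi := tangent_motion in IH *.
have delta_div G : divides F G -> divides F (delta G).
  case=> q ->; rewrite deltaM deltaF mulr0 addr0.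
  by apply: divides_mull; apply: divides_refl.
have e : V1 * (n.+1%:R * Phi`_n.+1) =
    V1 * delta Phi`_n - delta V1 * Phi`_n *+ n - (DX Phi)`_n.
  have eC : ((V1%:P + 'X * (delta V1)%:P) * Phi^`())`_n =
      V1 * (Phi`_n.+1 *+ n.+1) + delta V1 * (Phi`_n *+ n).
    rewrite mulrDl coefD coefCM coef_deriv ['X * _]mulrC -mulrA ['X * _]mulrC.
    rewrite coefCM coefMX coef_deriv.
    by case: (n) => [|k] //=; rewrite mulr0n.
  rewrite /DX coefB eC coefCM /delta_hat coefD !coefCM !coef_map /= -/(delta _).
  by rewrite mulr_natl -mulrnAr; ring.
have : divides F (V1 * (n.+1%:R * Phi`_n.+1)).
  rewrite e; apply: divides_sub; last exact: DX_motion.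
  apply: divides_sub; first by apply: divides_mull; apply: delta_div.
  by rewrite -mulr_natl; do 2! apply: divides_mull.
case/pF => // /pF [] // /not_divides_small [].
  by rewrite -polyC_natr polyC_eq0 -polyC_natr polyC_eq0 char_m.
by rewrite -polyC_natr size_polyC; apply: leq_ltn_trans sF; case: (_ != 0).
Qed.
End Tangent.

(** A tangent line to a curve of inflections is contained in it by the previous
    lemma, so a prime such curve divides the equation of its tangent line at
    [(z, w)]. The bound [m] keeps the degree below the characteristic: the curve
    [W = Z ^ p] has nothing but inflections. *)
Lemma inflection_curve_is_line (R : idomainType) (F : {poly {poly R}}) (m : nat) (z w : R) :
  prime_or_unit F -> (1 < size F)%N -> divides F (hessian F) ->
  ((sizeY F).-1 + (size F).-1 <= m)%N ->
  (forall n, (0 < n <= m)%N -> n%:R != 0 :> R) ->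
  F.[w, z] = 0 -> F^`().[w, z] != 0 ->
  forall z' w', F.[w', z'] = 0 ->
    F^`().[w, z] * (w' - w) = - (derivZ F).[w, z] * (z' - z).
Proof.
move=> pF sF hF dm char_m Fwz; set v1 := F^`().[w, z] => v10 z' w' Fwz'.
set v2 := - (derivZ F).[w, z].
have F0 : F != 0 by rewrite -size_poly_gt0 (leq_trans _ sF).
have nV1 : ~ divides F F^`().
  apply: not_divides_small; last exact: lt_size_deriv.
  by apply: contraNneq v10 => e; rewrite /v1 e !horner0.
have sPhi : (size (tangent_motion F) <= m.+1)%N.
  exact: leq_trans (size_tangent_motion F) _.
have Phi0 := tangent_motion_divides hF pF sF nV1 char_m sPhi.
have {Phi0} line0 : (map_poly (map_poly polyC) F).[w%:P + 'X * v2%:P, z%:P + 'X * v1%:P] = 0.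
  pose ev : {rmorphism {poly {poly R}} -> R} := horner_eval z \o horner_eval w%:P.
  have evE G : ev G = G.[w, z] by [].
  have e0 : map_poly ev (tangent_motion F) = 0.
    apply/polyP=> n; rewrite coef0 coef_map; case: (Phi0 n) => q ->.
    by rewrite -[LHS]/((q * F).[w, z]) !hornerM Fwz mulr0.
  move: e0; rewrite /tangent_motion rmorph_horner2 map_poly_comp2.
  have evL (Y V : {poly {poly R}}) : map_poly ev (Y%:P + 'X * V%:P) = Y.[w, z]%:P + 'X * V.[w, z]%:P.
    by rewrite rmorphD rmorphM /= map_polyX !map_polyC.
  rewrite /= !evL hornerX hornerC hornerC hornerX !hornerN -/v2 -/v1 => <-.
  congr (_.[_, _]); apply: eq_map_poly => c; apply: eq_map_poly => x /=.
  by rewrite map_polyC /= /horner_eval !hornerC.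
(* the equation of the tangent line at (z, w) *)
pose L : {poly {poly R}} := v1%:P%:P * 'X - (v2%:P * ('X - z%:P) + (v1 * w)%:P)%:P.
suff : divides F L.
  case=> q /(congr1 (fun G => G.[w', z'])); rewrite !hornerM Fwz' mulr0.
  rewrite /L !(hornerD, hornerN, hornerM, hornerC, hornerX) => /eqP; rewrite subr_eq0 => /eqP e.
  by rewrite mulrBr e; ring.
have sL : size L = 2.
  rewrite /L -polyCN mul_polyC size_addl ?size_scale ?size_polyX ?polyC_eq0 //.
  by rewrite ltnS size_polyC_leq1.
have lL : lead_coef L = v1%:P.
  by rewrite lead_coefE sL /L coefB coefCM coefX coefC /= mulr1 subr0.
(* the remainder of the pseudo-division of F by L vanishes on the line, hence
   is zero *)
have := Pdiv.Idomain.divp_eq F L; rewrite lL; set k := scalp F L; set Q := F %/ L.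
have L0 : L != 0 by rewrite -size_poly_gt0 sL.
have := ltn_modp F L; rewrite L0 sL ltnS => /size1_polyC ->; set r := (F %% L)`_0 => eL.
pose sub : {rmorphism {poly {poly R}} -> {poly R}} :=
  horner_eval (z%:P + 'X * v1%:P) \o (horner_eval (w%:P + 'X * v2%:P)%:P \o map_poly (map_poly polyC)).
have subL : sub L = 0.
  rewrite -[LHS]/((map_poly (map_poly polyC) L).[w%:P + 'X * v2%:P, z%:P + 'X * v1%:P]).
  rewrite /L rmorphB rmorphM /= map_polyX !map_polyC /= map_polyC /=.
  rewrite rmorphD rmorphM rmorphB /= map_polyX !map_polyC /=.
  rewrite !(hornerD, hornerN, hornerM, hornerC, hornerX) !polyCM.
  ring.
have r0 : r = 0.
  have : sub r%:P = 0.
    have := congr1 sub eL; rewrite -mul_polyC rmorphM rmorphD rmorphM subL mulr0 add0r => <-.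
    by rewrite [X in _ * X]line0 mulr0.
  rewrite /= /horner_eval map_polyC hornerC /= => /eqP.
  rewrite -/(comp_poly _ _) -size_poly_eq0 size_comp_poly2 ?size_poly_eq0; first by move/eqP.
  rewrite addrC mulrC mul_polyC size_addl ?size_scale ?size_polyX //.
  by rewrite ltnS size_polyC_leq1.
move: eL; rewrite r0 polyC0 addr0 -mul_polyC => eL.
have /pF [|//] : divides F (Q * L) by rewrite -eL; apply: divides_mull; apply: divides_refl.
case=> q eQ; exfalso; move: eL; rewrite eQ mulrAC => /(mulIf F0) e.
have := congr1 (fun G : {poly {poly R}} => size G) e.
have v1k0 : v1%:P ^+ k != 0 by rewrite expf_neq0 // polyC_eq0.
have q0 : q != 0 by apply: contraNneq v1k0 => q0; rewrite -polyC_eq0 e q0 mul0r.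
rewrite size_mul // sL size_polyC v1k0 addn2 /= => -[] /esym/eqP.
by rewrite size_poly_eq0 (negPf q0).
Qed.

(** * Partial degrees *)

Section Degrees.
Variable L : idomainType.
Notation T := {poly {poly {poly L}}}.
Implicit Types F G : T.

Lemma sizeYM (R : idomainType) (F G : {poly {poly R}}) : F != 0 -> G != 0 ->
  (sizeY (F * G)).-1 = ((sizeY F).-1 + (sizeY G).-1)%N.
Proof.
move=> F0 G0; rewrite !sizeYE rmorphM /= size_mul ?swapXY_eq0 //.
have arith x y : (0 < x -> 0 < y -> (x + y).-1.-1 = x.-1 + y.-1)%N by lia.
by rewrite arith // size_poly_gt0 swapXY_eq0.
Qed.

(** The innermost variable is moved to the outermost position, where [size]
    gives the degree in it. *)
Definition rotate F : T := swapXY (map_poly swapXY F).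

Lemma coef_rotate F i j k : (rotate F)`_k`_j`_i = F`_j`_i`_k.
Proof. by rewrite /rotate coef_swapXY coef_map /= coef_swapXY. Qed.

Lemma rotateM F G : rotate (F * G) = rotate F * rotate G.
Proof. by rewrite /rotate !rmorphM. Qed.

Lemma rotate_eq0 F : (rotate F == 0) = (F == 0).
Proof.
apply/eqP/eqP=> [e|->]; last by rewrite /rotate !rmorph0.
apply/polyP=> j; apply/polyP=> i; apply/polyP=> k.
by rewrite -coef_rotate e !coef0.
Qed.

Lemma size_coef_rotate F i j : (size (F`_j`_i)%R <= (size (rotate F)).-1.+1)%N.
Proof.
apply/leq_sizeP => k hk; rewrite -coef_rotate.
have -> : (rotate F)`_k = 0 by rewrite nth_default // (leq_trans (leqSpred _) hk).
by rewrite !coef0.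
Qed.

(** The sum of the partial degrees is at least the total degree, and its
    additivity follows from that of [size] alone. *)
Definition weight F : nat :=
  ((size (rotate F)).-1 + (sizeY F).-1 + (size F).-1)%N.

Lemma weightM F G : F != 0 -> G != 0 -> weight (F * G) = (weight F + weight G)%N.
Proof.
move=> F0 G0; rewrite /weight sizeYM // rotateM !size_mul ?rotate_eq0 //.
have arith x y : (0 < x -> 0 < y -> (x + y).-1.-1 = x.-1 + y.-1)%N by lia.
have regroup a b c d e f : (a + b + (c + d) + (e + f) = a + c + e + (b + d + f))%N by lia.
by rewrite !arith ?size_poly_gt0 ?rotate_eq0 // regroup.
Qed.

Lemma weight1 : weight 1 = 0%N.
Proof.
have e : size (rotate 1) = 1%N by rewrite /rotate !rmorph1 size_poly1.
by rewrite /weight e sizeYE rmorph1 !size_poly1.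
Qed.

Lemma weight_prod (s : seq T) : \prod_(F <- s) F != 0 ->
  weight (\prod_(F <- s) F) = (\sum_(F <- s) weight F)%N.
Proof.
elim: s => [|F s IH]; first by rewrite !big_nil weight1.
rewrite !big_cons mulf_eq0 negb_or => /andP[F0 s0].
by rewrite weightM // IH.
Qed.

Definition in_box a b c F : Prop :=
  [/\ forall j i, (size (F`_j`_i)%R <= a.+1)%N,
      forall j, (size (F`_j)%R <= b.+1)%N & (size F <= c.+1)%N].

Lemma in_box_self F : in_box (size (rotate F)).-1 (sizeY F).-1 (size F).-1 F.
Proof.
split=> [j i|j|]; first exact: size_coef_rotate.
  by apply: leq_trans (max_size_coefXY _ _) (leqSpred _).
exact: leqSpred.
Qed.

Lemma in_box_weight a b c F : in_box a b c F -> (weight F <= a + b + c)%N.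
Proof.
case=> ha hb hc; have arith x y : (x <= y.+1 -> x.-1 <= y)%N by lia.
rewrite /weight !leq_add //; apply: arith => //.
  apply/leq_sizeP => k hk; apply/polyP=> j; apply/polyP=> i.
  by rewrite coef_rotate !coef0 nth_default // (leq_trans (ha _ _)).
by apply/bigmax_leqP => i _; apply: hb.
Qed.

Lemma size_MnS (R : nzRingType) (P : {poly R}) n a : (size P <= a)%N -> (size (P *+ n)%R <= a)%N.
Proof.
move=> h; apply/leq_sizeP => k hk; rewrite coefMn nth_default ?mul0rn //.
exact: leq_trans hk.
Qed.

Lemma in_box_deriv a b c F : in_box a b c F -> in_box a b c F^`().
Proof.
case=> ha hb hc; split=> [j i|j|].
- by rewrite coef_deriv coefMn; apply/size_MnS/ha.
- by rewrite coef_deriv; apply/size_MnS/hb.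
- by apply: leq_trans (leq_trans (size_poly _ _) (leq_pred _)) hc.
Qed.

Lemma in_box_derivZ a b c F : in_box a b c F -> in_box a b c (derivZ F).
Proof.
case=> ha hb hc; split=> [j i|j|].
- by rewrite coef_map /= coef_deriv; apply/size_MnS/ha.
- by rewrite coef_map /=; apply: leq_trans (leq_trans (size_poly _ _) (leq_pred _)) (hb j).
- exact: leq_trans (size_poly _ _) hc.
Qed.

Lemma in_box_line a b c F (z w : {poly L}) : (size z <= 2)%N -> (size w <= 2)%N ->
  in_box a b c F -> (size F.[w, z] <= (a + b + c).+1)%N.
Proof. by move=> sz sw [ha hb hc]; apply: size_horner2_leS. Qed.

Lemma size_hessian_line a b c F (z w : {poly L}) : (size z <= 2)%N -> (size w <= 2)%N ->
  in_box a b c F -> (size (hessian F).[w, z] <= (3 * (a + b + c)).+1)%N.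
Proof.
move=> sz sw bF; have le G : in_box a b c G -> (size G.[w, z] <= (a + b + c).+1)%N.
  exact: in_box_line.
have bZ := in_box_derivZ bF; have bW := in_box_deriv bF.
have -> : (3 * (a + b + c) = (a + b + c) + ((a + b + c) + (a + b + c)))%N by lia.
rewrite -[_.[_, _]]/((horner_eval z \o horner_eval w%:P) _) rmorph_hessian !expr2 -!mulrA.
have M3 (P Q S : {poly L}) : (size P <= (a + b + c).+1 -> size Q <= (a + b + c).+1 -> size S <= (a + b + c).+1 ->
    size (P * (Q * S))%R <= ((a + b + c) + ((a + b + c) + (a + b + c))).+1)%N.
  by move=> *; do 2!apply: sizeM_leS => //.
have bZZ := in_box_derivZ bZ; have bZW := in_box_derivZ bW.
have bWZ := in_box_deriv bZ; have bWW := in_box_deriv bW.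
apply: sizeD_le; last by apply: M3; apply: le.
apply: sizeB_le; apply: M3; try exact: le.
by apply: sizeD_le; apply: le.
Qed.

Lemma size_hessian (R : comNzRingType) (F : {poly {poly R}}) c : (size F <= c.+1)%N ->
  (size (hessian F) <= (3 * c).+1)%N.
Proof.
move=> sF.
have dW (G : {poly {poly R}}) : (size G <= c.+1)%N -> (size (G^`())%R <= c.+1)%N.
  by move=> h; apply: leq_trans (leq_trans (size_poly _ _) (leq_pred _)) h.
have dZ (G : {poly {poly R}}) : (size G <= c.+1)%N -> (size (derivZ G) <= c.+1)%N.
  by move=> h; apply: leq_trans (size_poly _ _) h.
have -> : (3 * c = c + (c + c))%N by lia.
rewrite /hessian !expr2 -!mulrA.
have M3 (P Q S : {poly {poly R}}) : (size P <= c.+1 -> size Q <= c.+1 -> size S <= c.+1 ->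
    size (P * (Q * S))%R <= (c + (c + c)).+1)%N.
  by move=> *; do 2!apply: sizeM_leS => //.
apply: sizeD_le; last by apply: M3; auto.
apply: sizeB_le; apply: M3; auto.
by apply: sizeD_le; auto.
Qed.

Lemma sizeY_le (R : nzRingType) (F : {poly {poly R}}) b :
  (sizeY F <= b)%N <-> (forall j, (size (F`_j)%R <= b)%N).
Proof.
split=> [h j|h]; first exact: leq_trans (max_size_coefXY _ _) h.
by apply/bigmax_leqP => i _; apply: h.
Qed.

Lemma sizeY_hessian (R : comNzRingType) (F : {poly {poly R}}) b : (sizeY F <= b.+1)%N ->
  (sizeY (hessian F) <= (3 * b).+1)%N.
Proof.
move=> sF.
have dW (G : {poly {poly R}}) : (sizeY G <= b.+1)%N -> (sizeY (G^`())%R <= b.+1)%N.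
  by move/sizeY_le => h; apply/sizeY_le => j; rewrite coef_deriv; apply/size_MnS.
have dZ (G : {poly {poly R}}) : (sizeY G <= b.+1)%N -> (sizeY (derivZ G) <= b.+1)%N.
  move/sizeY_le => h; apply/sizeY_le => j; rewrite coef_map /=.
  by apply: leq_trans (leq_trans (size_poly _ _) (leq_pred _)) (h j).
have -> : (3 * b = b + (b + b))%N by lia.
have eH := rmorph_hessian (@swapXY R : {rmorphism {poly {poly R}} -> {poly {poly R}}}) F.
rewrite sizeYE eH.
rewrite 2!expr2.
rewrite -!mulrA.
have M3 (P Q S : {poly {poly R}}) : (sizeY P <= b.+1 -> sizeY Q <= b.+1 -> sizeY S <= b.+1 ->
    size (swapXY P * (swapXY Q * swapXY S))%R <= (b + (b + b)).+1)%N.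
  by rewrite !sizeYE => *; do 2!apply: sizeM_leS => //.
apply: sizeD_le; last by apply: M3; auto.
apply: sizeB_le; first by apply: M3; auto.
rewrite -rmorphD; apply: M3; auto.
by rewrite sizeYE rmorphD /= sizeD_le // -sizeYE; auto.
Qed.

End Degrees.

(** * Lines meeting at a point of a surface *)

Section Slice.
Variable L : fieldType.
Notation T := {poly {poly {poly L}}}.
Implicit Types F G : T.

Definition slice (u : L) F : {poly {poly L}} := map_poly (map_poly (horner_eval u)) F.

Lemma horner_slice u F (z w : {poly L}) :
  F.[w, z].[u] = (slice u F).[w.[u], z.[u]].
Proof. by rewrite -[LHS]/(horner_eval u _) rmorph_horner2. Qed.

Lemma deriv_line F (z w : {poly L}) :
  (F.[w, z])^`() = (map_poly (map_poly (@deriv L)) F).[w, z]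
     + (derivZ F).[w, z] * z^`() + F^`().[w, z] * w^`().
Proof.
have id2 (G : T) : map_poly (map_poly (idfun : {rmorphism {poly L} -> {poly L}})) G = G.
  by rewrite map_poly_id // => c _; rewrite map_poly_id.
have := @chain_rule2 _ _ idfun (@deriv L) (@deriv L) (@derivD L) (@derivM L) (fun=> erefl) F w z.
by rewrite !id2.
Qed.

(** A conic that meets the line [a + b x + c y = 0] in three points contains it,
    and so its point at infinity [(c, - b)]. *)
Lemma conic_line (a b c k l m q r s : L) (x y : 'I_3 -> L) : injective x ->
  (forall j, a + b * x j + c * y j = 0) ->
  (forall j, k + l * x j + m * y j + q * x j ^+ 2 + r * (x j * y j) + s * y j ^+ 2 = 0) ->
  q * c ^+ 2 - r * b * c + s * b ^+ 2 = 0.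
Proof.
move=> xI lin quad.
pose i0 : 'I_3 := inord 0; pose i1 : 'I_3 := inord 1; pose i2 : 'I_3 := inord 2.
have n01 : x i0 - x i1 != 0 by rewrite subr_eq0 (inj_eq xI) -val_eqE /= !inordK.
have n02 : x i0 - x i2 != 0 by rewrite subr_eq0 (inj_eq xI) -val_eqE /= !inordK.
have n12 : x i1 - x i2 != 0 by rewrite subr_eq0 (inj_eq xI) -val_eqE /= !inordK.
have [c0|c0] := eqVneq c 0.
  have : b * (x i0 - x i1) = 0.
    have := lin i0; have := lin i1; rewrite c0 !mul0r !addr0 => e1 e0.
    by rewrite mulrBr -[b * x i0](addrK a) addrC -[b * x i1](addrK a) addrC; move: e0 e1; rewrite ![a + _]addrC => -> ->; ring.
  move/eqP; rewrite mulf_eq0 (negPf n01) orbF => /eqP ->.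
  by rewrite c0; ring.
set h := _ + _.
have E j : h * x j ^+ 2 + (l * c ^+ 2 - m * b * c - r * a * c + 2 * s * a * b) * x j
   + (k * c ^+ 2 - m * a * c + s * a ^+ 2) = 0.
  have -> : h * x j ^+ 2 + (l * c ^+ 2 - m * b * c - r * a * c + 2 * s * a * b) * x j
   + (k * c ^+ 2 - m * a * c + s * a ^+ 2) =
   c ^+ 2 * (k + l * x j + m * y j + q * x j ^+ 2 + r * (x j * y j) + s * y j ^+ 2)
   - (a + b * x j + c * y j) * (m * c + r * c * x j + s * (c * y j - a - b * x j)).
    by rewrite /h; ring.
  by rewrite lin quad; ring.
move: (l * _ - _ - _ + _) (k * _ - _ + _) E => M N E.
have D1 : h * (x i0 + x i1) + M = 0.
  apply: (mulfI n01); rewrite mulr0 -[RHS](subrr 0) -{1}(E i0) -(E i1); ring.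
have D2 : h * (x i0 + x i2) + M = 0.
  apply: (mulfI n02); rewrite mulr0 -[RHS](subrr 0) -{1}(E i0) -(E i2); ring.
apply: (mulIf n12); rewrite mul0r -[RHS](subrr 0) -{1}D1 -D2; ring.
Qed.

(** The directions [(1, z', w')] of lines of the surface through a point satisfy
    a linear and a quadratic equation, whose coefficients are the first and the
    second derivatives of [F]. With three such directions, the quadratic one
    vanishes at the point at infinity of the linear one, which is the tangent
    direction of the section by the plane of constant parameter [u]. *)
Lemma three_lines_hessian F u x0 y0 (z w : 'I_3 -> {poly L}) :
  (forall j, (size (z j) <= 2)%N) -> (forall j, (size (w j) <= 2)%N) ->
  (forall j, F.[w j, z j] = 0) ->
  (forall j, (z j).[u] = x0) -> (forall j, (w j).[u] = y0) ->
  injective (fun j => (z j)^`().[u]) ->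
  (slice u (hessian F)).[y0, x0] = 0.
Proof.
move=> sz sw Fl zu wu inj.
have d2 (q : {poly L}) : (size q <= 2)%N -> q^`()^`() = 0.
  move=> sq; apply/polyP=> i; rewrite !coef_deriv coef0 nth_default ?mul0rn //.
  by rewrite (leq_trans sq).
pose dt (G : T) : T := map_poly (map_poly (@deriv L)) G.
pose ev (G : T) := (slice u G).[y0, x0].
have evE G j : G.[w j, z j].[u] = ev G by rewrite horner_slice wu zu.
have first j : ev (dt F) + ev (derivZ F) * (z j)^`().[u] + ev F^`() * (w j)^`().[u] = 0.
  have := congr1 (fun q : {poly L} => q^`().[u]) (Fl j).
  by rewrite /= deriv_line deriv0 horner0 !hornerD !hornerM !evE.
have second j : ev (dt (dt F)) + (ev (derivZ (dt F)) + ev (dt (derivZ F))) * (z j)^`().[u]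
   + (ev (dt F)^`() + ev (dt F^`())) * (w j)^`().[u]
   + ev (derivZ (derivZ F)) * (z j)^`().[u] ^+ 2
   + (ev (derivZ F^`()) + ev (derivZ F)^`()) * ((z j)^`().[u] * (w j)^`().[u])
   + ev F^`()^`() * (w j)^`().[u] ^+ 2 = 0.
  have := congr1 (fun q : {poly L} => q^`()^`().[u]) (Fl j).
  have dz := d2 _ (sz j); have dw := d2 _ (sw j).
  rewrite /= deriv_line !derivD !derivM dz dw !mulr0 !addr0 !deriv_line !deriv0 horner0.
  rewrite !(hornerD, hornerM) !evE => <-.
  have regroup (a1 a2 a3 b1 b2 b3 c1 c2 c3 x y : L) :
    a1 + (a2 + b1) * x + (a3 + c1) * y + b2 * x ^+ 2 + (c2 + b3) * (x * y) + c3 * y ^+ 2 =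
    a1 + a2 * x + a3 * y + (b1 + b2 * x + b3 * y) * x + (c1 + c2 * x + c3 * y) * y by ring.
  exact: regroup.
have evH : ev (hessian F) = ev (derivZ (derivZ F)) * ev F^`() ^+ 2
    - (ev (derivZ F^`()) + ev (derivZ F)^`()) * ev (derivZ F) * ev F^`()
    + ev F^`()^`() * ev (derivZ F) ^+ 2.
  exact: (rmorph_hessian (horner_eval x0 \o (horner_eval y0%:P \o map_poly (map_poly (horner_eval u))))).
by rewrite -/(ev _) evH; apply: conic_line inj first second.
Qed.

(** Otherwise [tau - u] would divide [F]. *)
Lemma slice_neq0 F u : prime_or_unit F -> (1 < size F)%N -> slice u F != 0.
Proof.
move=> pF sF; apply/eqP => s0.
have F0 : F != 0 by rewrite -size_poly_gt0 (leq_trans _ sF).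
have X0 : 'X - u%:P != 0 :> {poly L} by rewrite polyXsubC_eq0.
pose X : T := ('X - u%:P)%:P%:P.
pose F' : T := map_poly (map_poly (fun r => r %/ ('X - u%:P))) F.
have eF : F = F' * X.
  apply/polyP=> j; apply/polyP=> i; rewrite !coefMC !coef_map_id0 ?div0p ?map_polyE //=; last first.
    by rewrite polyseq0.
  rewrite divpK // dvdp_XsubCl; apply/rootP.
  by have /polyP/(_ j)/polyP/(_ i) := s0; rewrite !coef_map !coef0.
have /pF[] : divides F (F' * X) by rewrite -eF; apply: divides_refl.
  case=> q e; move: eF; rewrite e -mulrA [F * X]mulrC mulrA => /esym/eqP.
  rewrite -{2}[F]mul1r (inj_eq (mulIf F0)) => /eqP e1.
  have q0 : q != 0 by apply: contra_eq_neq e1 => ->; rewrite mul0r eq_sym oner_eq0.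
  have := congr1 (fun G : T => G`_0`_0) e1.
  rewrite !coefMC !coef1 /= => /(congr1 (fun r : {poly L} => r.[u])).
  by rewrite hornerM hornerXsubC subrr mulr0 hornerC => /eqP; rewrite eq_sym oner_eq0.
apply: not_divides_small; first by rewrite !polyC_eq0.
by rewrite size_polyC polyC_eq0 X0.
Qed.

(** The monomials [Z ^ i W ^ j] with [i < n] have distinct degrees after the
    substitution [W = c Z ^ n]. *)
Lemma base_substitution_neq0 (Q : {poly {poly L}}) (c : L) n :
  Q != 0 -> c != 0 -> (sizeY Q <= n)%N -> Q.[c *: 'X^n] != 0.
Proof.
move=> Q0 c0 sQ; rewrite -size_poly_gt0.
have e : size Q = (size Q).-1.+1 by rewrite prednK // size_poly_gt0.
rewrite horner_coef e big_ord_recr /= -/(lead_coef Q); set d := (size Q).-1.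
have l0 : lead_coef Q != 0 by rewrite lead_coef_eq0.
have sl : size (lead_coef Q * (c *: 'X^n) ^+ d) = (size (lead_coef Q) + n * d)%N.
  rewrite exprZn -exprM -scalerAr size_scale ?expf_neq0 //.
  by rewrite size_mulXn // addnC.
rewrite addrC size_addl sl ?addn_gt0 ?size_poly_gt0 ?l0 //.
apply: (@leq_ltn_trans (n * d)); last by rewrite -addn1 addnC leq_add2r size_poly_gt0.
apply: size_sum_le => i _.
rewrite exprZn -exprM -scalerAr; apply: leq_trans (size_scale_leq _ _) _.
have [->|Qi] := eqVneq Q`_i 0; first by rewrite mul0r size_poly0.
rewrite size_mulXn //; apply: leq_trans (leq_add (leqnn _) (leq_trans (max_size_coefXY _ _) sQ)) _.
by rewrite -mulnSr leq_mul2l ltn_ord orbT.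
Qed.

(** With [n] the characteristic, [c * x ^+ n] is up to a factor the conjugate of
    [x]: a plane curve of degree [d] in [x] and its conjugate has about [d n]
    points in a quadratic extension of the prime field. *)
Lemma slice_zeros F u c n (s : seq L) :
  prime_or_unit F -> (1 < size F)%N -> (sizeY F <= n)%N -> c != 0 -> uniq s ->
  (forall x, x \in s -> (slice u F).[c * x ^+ n, x] = 0) ->
  (size s <= (sizeY F).-1 + n * (size F).-1)%N.
Proof.
move=> pF sF sY c0 us hs.
have h0 : (slice u F).[c *: 'X^n] != 0.
  apply: base_substitution_neq0 => //; first exact: slice_neq0.
  apply/sizeY_le => j; rewrite coef_map /=; apply: leq_trans (size_poly _ _) _.
  exact: leq_trans (max_size_coefXY _ _) sY.
rewrite -ltnS; apply: leq_trans (max_poly_roots h0 _ us) _.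
  apply/allP => x xs; apply/rootP; rewrite -[RHS](hs x xs).
  rewrite -[LHS]/(horner_eval x _) -horner_map /= {2}/horner_eval hornerZ hornerXn.
  by rewrite -[in RHS]/(horner_eval x _) -horner_map /= {3}/horner_eval hornerC.
rewrite horner_coef; apply: size_sum_le => i _.
have [->|Qi] := eqVneq (slice u F)`_i 0; first by rewrite mul0r size_poly0.
rewrite exprZn -exprM -scalerAr; apply: leq_trans (size_scale_leq _ _) _.
rewrite size_mulXn // addnC -addSn leq_add //.
  rewrite coef_map /=; apply: leq_trans (size_poly _ _) _.
  exact: leq_trans (max_size_coefXY _ _) (leqSpred _).
rewrite leq_mul2l; apply/orP; right; rewrite -ltnS.
have := leq_trans (ltn_ord i) (size_poly _ _); rewrite prednK //.
exact: leq_trans sF.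
Qed.

End Slice.

(** * Surfaces through few points *)

Section Interpolation.
Variable L : fieldType.

Lemma wide_matrix_kernel (m k : nat) (M : 'M[L]_(m, k)) : (k < m)%N ->
  exists2 v : 'rV_m, v != 0 & v *m M = 0.
Proof.
move=> km; have : kermx M != 0.
  by rewrite kermx_eq0 /row_free neq_ltn (leq_ltn_trans (rank_leq_col M)).
by case/rowV0Pn => v /sub_kermxP vM v0; exists v.
Qed.

(** There are more coefficients than conditions. *)
Lemma interpolation (pts : seq (L * L * L)) n : (size pts < n.+1 ^ 3)%N ->
  exists F : {poly {poly {poly L}}}, [/\ F != 0, in_box n n n F &
    forall u x y, (u, x, y) \in pts -> (slice u F).[y, x] = 0].
Proof.
move=> small; pose I := ('I_n.+1 * 'I_n.+1 * 'I_n.+1)%type.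
have cI : #|{: I}| = (n.+1 ^ 3)%N by rewrite !card_prod card_ord expnSr expnS expn1.
pose mon (t : I) (q : L * L * L) := q.1.1 ^+ t.1.1 * q.1.2 ^+ t.1.2 * q.2 ^+ t.2.
pose M := \matrix_(r < #|{: I}|, c < size pts) mon (enum_val r) (nth (0, 0, 0) pts c).
have [v v0 vM] : exists2 v : 'rV_#|{: I}|, v != 0 & v *m M = 0.
  by apply: wide_matrix_kernel; rewrite cI.
pose c (t : I) := v 0 (enum_rank t).
pose F : {poly {poly {poly L}}} :=
  \poly_(j < n.+1) \poly_(i < n.+1) \poly_(k < n.+1) c (inord k, inord i, inord j).
exists F; split.
- apply: contra_neq v0 => F0; apply/rowP => r; rewrite mxE.
  have := congr1 (fun G : {poly {poly {poly L}}} => 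
    G`_(enum_val r).2`_(enum_val r).1.2`_(enum_val r).1.1) F0.
  rewrite /F !coef_poly !ltn_ord !coef_poly !ltn_ord !coef_poly !ltn_ord !coef0 /c !inord_val.
  by rewrite -!surjective_pairing enum_valK.
- split=> [j i|j|]; last exact: size_poly.
    rewrite coef_poly; case: ifP => _; last by rewrite !coef0 size_poly0.
    by rewrite coef_poly; case: ifP => _; rewrite ?size_poly0 // size_poly.
  by rewrite coef_poly; case: ifP => _; rewrite ?size_poly0 // size_poly.
move=> u x y q.
have -> : (slice u F).[y, x] = F.[y%:P, x%:P].[u].
  by rewrite horner_slice !hornerC.
pose e := index (u, x, y) pts; have he : (e < size pts)%N by rewrite index_mem.
have <- : (v *m M) 0 (Ordinal he) = F.[y%:P, x%:P].[u]; last by rewrite vM mxE.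
rewrite mxE (reindex (@enum_rank I)) /=; last first.
  by apply: onW_bij; apply: enum_rank_bij.
rewrite (eq_bigr (fun t : I => c (t.1, t.2) * mon (t.1, t.2) (u, x, y))); last first.
  by move=> [t1 t2] _; rewrite mxE enum_rankK /= nth_index.
rewrite -(pair_bigA _ (fun t1 t2 => c (t1, t2) * mon (t1, t2) (u, x, y))) /=.
rewrite (eq_bigr (fun t1 : 'I_n.+1 * 'I_n.+1 =>
  \sum_(j < n.+1) c ((t1.1, t1.2), j) * mon ((t1.1, t1.2), j) (u, x, y))); last first.
  by move=> [].
rewrite -(pair_bigA _ (fun k i => \sum_(j < n.+1) c ((k, i), j) * mon ((k, i), j) (u, x, y))) /=.
rewrite horner_poly !horner_sum exchange_big /=.
under eq_bigr => i _ do rewrite exchange_big.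
rewrite exchange_big /=; apply: eq_bigr => j _.
rewrite -!rmorphXn /= hornerM hornerC hornerM hornerC horner_poly horner_sum mulr_suml.
apply: eq_bigr => i _.
rewrite hornerM -rmorphXn /= hornerC horner_poly !mulr_suml.
by apply: eq_bigr => k _; rewrite !inord_val /mon /=; ring.
Qed.

End Interpolation.

(** Each line of the surface lies on a prime component, and the weights of the
    components add up; so the ratio of lines to weight is as large for one of
    them as for the surface. *)
Lemma rich_prime_factor (L : fieldType) (I : finType) (S : {set I})
    (z w : I -> {poly L}) (k : nat) (F0 : {poly {poly {poly L}}}) : F0 != 0 ->
  (forall l, l \in S -> F0.[w l, z l] = 0) -> (k * weight F0 < #|S|)%N ->
  exists F : {poly {poly {poly L}}}, [/\ prime_or_unit F, F != 0, (weight F <= weight F0)%N &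
    (k * weight F < #|[set l in S | (F.[w l, z l] == 0)%R]|)%N].
Proof.
move=> F00 SF0 many.
have fact : factorial_ring {poly {poly {poly L}}}.
  by do 3!apply: factorial_poly; apply: field_factorial.
have [s ps eF0] := fact F0 F00; rewrite eF0 in F00 SF0 many *.
rewrite weight_prod // in many *.
have s0 F : F \in s -> F != 0.
  by move=> Fs; apply: contra_neq F00 => e; apply/eqP; rewrite prodf_seq_eq0; apply/hasP; exists F; rewrite //= e eqxx.
pose N (F : {poly {poly {poly L}}}) := #|[set l in S | (F.[w l, z l] == 0)%R]|.
have : has (fun F => (k * weight F < N F)%N) s.
  apply: contraT => /hasPn hs; move: many; rewrite ltnNge => /negP; case.
  apply: (@leq_trans (\sum_(F <- s) N F)%N); last first.
    by rewrite big_distrr /= big_seq [leqRHS]big_seq; apply: leq_sum => F /hs; rewrite -leqNgt.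
  have sub l : l \in S -> has (fun F : {poly {poly {poly L}}} => F.[w l, z l] == 0) s.
    move=> /SF0 /eqP; rewrite -[_.[_, _]]/((horner_eval (z l) \o horner_eval (w l)%:P) _).
    by rewrite rmorph_prod prodf_seq_eq0 => /hasP[F Fs e]; apply/hasP; exists F.
  rewrite /N; under eq_bigr => F _ do rewrite -sum1_card big_mkcond /=.
  rewrite exchange_big -sum1_card big_mkcond /=; apply: leq_sum => l _.
  case: ifP => // lS; have /hasP[F Fs e] := sub _ lS.
  by rewrite (big_rem F) //= inE lS e leq_addr.
case/hasP => F Fs hF; exists F; split => //; first exact: ps.
  exact: s0.
by rewrite (big_rem F) //= leq_addr.
Qed.

(** * Counting *)

Lemma few_poor_points (I : finType) (V : eqType) (S : {set I}) (f : I -> V) (r : seq V) k :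
  (forall l, l \in S -> f l \in r) ->
  (#|[set l in S | #|[set l' in S | f l' == f l]| <= k]| <= k * size r)%N.
Proof.
move=> fr; set P := [set l in S | _].
have -> : (k * size r = \sum_(v <- r) k)%N by rewrite big_const_seq count_predT iter_addn_0.
apply: (@leq_trans (\sum_(v <- r) #|[set l in P | f l == v]|)); last first.
  apply: leq_sum => v _; have [->|[l]] := set_0Vmem [set l in P | f l == v].
    by rewrite cards0.
  rewrite !inE => /andP[/andP[lS lk] /eqP fl]; apply: leq_trans lk.
  apply/subset_leq_card/subsetP => l'; rewrite !inE => /andP[/andP[-> _] /eqP ->].
  by rewrite fl eqxx.
under eq_bigr => v _ do rewrite -sum1_card big_mkcond /=.
rewrite exchange_big -sum1_card big_mkcond /=; apply: leq_sum => l _.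
case: ifP => // lP; rewrite (big_rem (f l)) ?fr //=; last by move: lP; rewrite inE => /andP[].
by rewrite inE lP eqxx leq_addr.
Qed.

(** * The lines of a product set *)

Section ProductLines.
Variables (L : fieldType) (p : nat) (pL : p \in [pchar L]).
Variables (V : finType) (zeta : V -> L) (zetaI : injective zeta).
Variables (A B : {set V}).
Hypotheses (cA : (#|A| <= p)%N) (cB : (#|B| <= p)%N).
Notation T := {poly {poly {poly L}}}.
Implicit Type l : V * V.

Let p_gt0 : (0 < p)%N. Proof. exact: prime_gt0 (pcharf_prime pL). Qed.

(** The line of motions that take the second point to the first: at a rotation
    [u] its coordinates are the translation part and, by Frobenius, [u] times the
    conjugate of the latter. *)
Definition lineZ l : {poly L} := (zeta l.1)%:P - (zeta l.2)%:P * 'X.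
Definition lineW l : {poly L} := (zeta l.1 ^+ p)%:P * 'X - (zeta l.2 ^+ p)%:P.

Lemma frobeniusB (x y : L) : (x - y) ^+ p = x ^+ p - y ^+ p.
Proof. by rewrite -!(pFrobenius_autE pL) rmorphB. Qed.

Lemma size_lineZ l : (size (lineZ l) <= 2)%N.
Proof.
apply: sizeB_le; first by apply: leq_trans (size_polyC_leq1 _) _.
by apply: (@sizeM_leS _ _ _ 0 1); rewrite ?size_polyX ?size_polyC_leq1.
Qed.

Lemma size_lineW l : (size (lineW l) <= 2)%N.
Proof.
apply: sizeB_le; last by apply: leq_trans (size_polyC_leq1 _) _.
by apply: (@sizeM_leS _ _ _ 0 1); rewrite ?size_polyX ?size_polyC_leq1.
Qed.

Lemma horner_lineZ l u : (lineZ l).[u] = zeta l.1 - u * zeta l.2.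
Proof. by rewrite /lineZ !(hornerD, hornerN, hornerM, hornerC, hornerX) mulrC. Qed.

Lemma horner_lineW l u : u ^+ p.+1 = 1 ->
  (lineW l).[u] = u * (zeta l.1 - u * zeta l.2) ^+ p.
Proof.
move=> u1; rewrite frobeniusB exprMn mulrBr mulrA -exprS u1 mul1r.
by rewrite /lineW !(hornerD, hornerN, hornerM, hornerC, hornerX) mulrC.
Qed.

Lemma lineZ_inj : injective lineZ.
Proof.
move=> [a b] [a' b'] e.
have := congr1 (fun q : {poly L} => q`_0) e; have := congr1 (fun q : {poly L} => q`_1) e.
rewrite /lineZ /= !coefB !coefC !coefCM !coefX /= !mulr1 !sub0r !mulr0 !subr0.
by move=> /oppr_inj /zetaI -> /zetaI ->.
Qed.

Lemma coefs_lineB l l' : 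
  lineZ l - lineZ l' = (zeta l.1 - zeta l'.1)%:P - (zeta l.2 - zeta l'.2)%:P * 'X
  /\ lineW l - lineW l' = ((zeta l.1 - zeta l'.1) ^+ p)%:P * 'X - ((zeta l.2 - zeta l'.2) ^+ p)%:P.
Proof. by rewrite !frobeniusB /lineZ /lineW !rmorphB /=; split; ring. Qed.

(** For each rotation the lines of [S] meet the corresponding plane in collinear
    points. If two of them have the same first index, comparing constant terms
    shows that all have it, and the second index is injective on [S]; otherwise
    the first index is. *)
Lemma parallel_lines (S : {set V * V}) (v1 v2 : {poly L}) :
  S \subset setX A B -> v1 != 0 ->
  {in S &, forall l l', v1 * (lineW l - lineW l') = v2 * (lineZ l - lineZ l')} ->
  (#|S| <= p)%N.
Proof.
move=> sS v10 par.
have [inj|] := boolP [forall l in S, forall l' in S, (l.1 == l'.1) ==> (l == l')].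
  apply: leq_trans cA.
  have injS : {in S &, injective fst}.
    move=> l l' lS lS' e; move/forall_inP/(_ l lS)/forall_inP/(_ l' lS')/implyP: inj => h.
    by apply/eqP/h; rewrite e.
  rewrite -(card_in_imset injS); apply/subset_leq_card/subsetP => _ /imsetP[l lS ->].
  by move/subsetP/(_ l lS): sS; rewrite inE => /andP[].
rewrite negb_forall_in => /exists_inP[l0 l0S]; rewrite negb_forall_in => /exists_inP[l1 l1S].
rewrite negb_imply => /andP[/eqP e01 n01].
have same l : l \in S -> l.1 = l0.1.
  move=> lS; apply: zetaI; apply/eqP; rewrite -subr_eq0.
  have := par _ _ l0S l1S; have := par _ _ lS l0S.
  case: (coefs_lineB l l0) => -> ->; case: (coefs_lineB l0 l1) => -> ->.
  set x := zeta l.1 - _; set y := zeta l.2 - _; set b := zeta l0.2 - _.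
  have -> : zeta l0.1 - zeta l1.1 = 0 by rewrite e01 subrr.
  have b0 : b != 0.
    rewrite subr_eq0; apply: contra n01 => /eqP /zetaI e2.
    by rewrite [l0]surjective_pairing [l1]surjective_pairing e01 e2.
  rewrite expr0n -[p]prednK //= polyC0 mul0r !sub0r !prednK // => h1 h2.
  have e : v1 * ('X * (b%:P * (x ^+ p)%:P * 'X - (b * y ^+ p)%:P - ((b ^+ p)%:P * - y%:P)) - (b ^+ p)%:P * x%:P) = 0.
    have -> : v1 * ('X * (b%:P * (x ^+ p)%:P * 'X - (b * y ^+ p)%:P - ((b ^+ p)%:P * - y%:P)) - (b ^+ p)%:P * x%:P)
      = b%:P * 'X * (v1 * ((x ^+ p)%:P * 'X - (y ^+ p)%:P)) + (v1 * - (b ^+ p)%:P) * (x%:P - y%:P * 'X).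
      by rewrite rmorphM /=; ring.
    by rewrite h1 h2; ring.
  move/eqP: e; rewrite mulf_eq0 (negPf v10) => /eqP /(congr1 (fun q : {poly L} => q.[0])).
  rewrite hornerD hornerM hornerX mul0r add0r hornerN hornerM !hornerC ?horner0 => /eqP.
  by rewrite oppr_eq0 mulf_eq0 expf_eq0 (negPf b0) andbF.
apply: leq_trans cB.
have injS : {in S &, injective snd}.
  by move=> l l' /same e1 /same e2 e; rewrite [l]surjective_pairing [l']surjective_pairing e1 e2 e.
rewrite -(card_in_imset injS); apply/subset_leq_card/subsetP => _ /imsetP[l lS ->].
by move/subsetP/(_ l lS): sS; rewrite inE => /andP[].
Qed.

Section Component.
Variables (F : T) (pF : prime_or_unit F) (F0 : F != 0).
Variables (U : seq L) (uU : uniq U) (normU : forall u, u \in U -> u ^+ p.+1 = 1).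

Let S := [set l in setX A B | F.[lineW l, lineZ l] == 0].
Let f := weight F.
Let a := (size (rotate F)).-1.
Let b := (sizeY F).-1.
Let c := (size F).-1.

Hypotheses (U_gt0 : (0 < size U)%N) (fU : (6 * f <= size U)%N) (fp : (20 * f <= p)%N).
Hypothesis many : (20 * p * f < #|S|)%N.

Let onS l : l \in S -> F.[lineW l, lineZ l] = 0.
Proof. by rewrite inE => /andP[_ /eqP]. Qed.

Let fE : f = (a + b + c)%N. Proof. by []. Qed.

Let boxF : in_box a b c F. Proof. exact: in_box_self. Qed.

(* otherwise the surface is given by an equation in Z, which has few roots *)
Let sF : (1 < size F)%N.
Proof.
rewrite ltnNge; apply/negP => s1; have eF := size1_polyC s1.
suff : (#|S| <= b)%N.
  by move: many; rewrite fE; have : (0 < p)%N := p_gt0; nia.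
have q0 : F`_0 != 0 by rewrite -polyC_eq0 -eF.
have : (size [seq lineZ l | l <- enum S] < size (F`_0)%R)%N.
  apply: max_poly_roots => //; last by rewrite map_inj_uniq ?enum_uniq //; apply: lineZ_inj.
  apply/allP => _ /mapP[l lS ->]; rewrite mem_enum in lS; apply/rootP.
  by have := onS lS; rewrite {1}eF hornerC.
rewrite size_map -cardE => h; rewrite -ltnS; apply: leq_trans h _.
by case: boxF.
Qed.

Let c_gt0 : (0 < c)%N. Proof. by rewrite /c; lia. Qed.

Let natL_neq0 n : (0 < n <= f)%N -> n%:R != 0 :> L.
Proof.
move=> /andP[n0 nf]; rewrite -(dvdn_pcharf pL); apply/negP => /(dvdn_leq n0).
by move: fp c_gt0; rewrite fE in nf *; lia.
Qed.

(** The first coordinate determines the line, so the resultant does not lose any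
    of the lines. *)
Lemma common_lines (S' : {set V * V}) (Q : T) : S' \subset S -> ~ divides F Q ->
  (forall l, l \in S' -> Q.[lineW l, lineZ l] = 0) ->
  (#|S'| <= (size Q).-1 * b + c * (sizeY Q).-1)%N.
Proof.
move=> sS' nd Q0.
rewrite cardE -(size_map (fun l => (lineZ l, lineW l))); apply: bezout_bound => //.
- by rewrite -map_comp map_inj_uniq ?enum_uniq //; apply: lineZ_inj.
- move=> _ /mapP[l lS ->] /=; rewrite mem_enum in lS; apply: onS.
  by move/subsetP: sS'; apply.
- by move=> _ /mapP[l lS ->] /=; rewrite mem_enum in lS; apply: Q0.
Qed.

Let sweep u l : L := zeta l.1 - u * zeta l.2.
Let poor u := [set l in S | (#|[set l' in S | sweep u l' == sweep u l]| <= 2)%N].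

Let card_poor u : u \in U -> (#|poor u| <= 2 * (p * f))%N.
Proof.
move=> uU'; pose r := undup [seq sweep u l | l <- enum S].
apply: leq_trans (few_poor_points (r := r) 2 _) _.
  by move=> l lS; rewrite mem_undup; apply: map_f; rewrite mem_enum.
rewrite leq_mul2l /=.
have u0 : u != 0.
  by apply: contra_eq_neq (normU uU') => ->; rewrite expr0n eq_sym oner_eq0.
have : (size r <= (sizeY F).-1 + p * (size F).-1)%N.
  apply: (slice_zeros (u := u) (c := u)) => //; last first.
  - move=> x; rewrite mem_undup => /mapP[l lS ->]; rewrite mem_enum in lS.
    have /(congr1 (fun q : {poly L} => q.[u])) := onS lS.
    by rewrite horner_slice horner_lineW ?normU // horner_lineZ horner0.
  - exact: undup_uniq.
  by apply: leq_trans (leqSpred _) _; rewrite -/b; move: fp c_gt0; rewrite fE; lia.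
by move=> h; apply: leq_trans h _; rewrite -/b -/c fE; have := p_gt0; nia.
Qed.

Let rich_hessian u l : u \in U -> l \in S -> l \notin poor u ->
  (hessian F).[lineW l, lineZ l].[u] = 0.
Proof.
move=> uU' lS; rewrite inE lS /= -ltnNge (cardD1 l) inE lS eqxx add1n ltnS.
move=> /card_gt1P[l1 [l2 []]]; rewrite !inE => /and3P[n1 l1S e1] /and3P[n2 l2S e2] n12.
have {}l1S : l1 \in S by rewrite !inE.
have {}l2S : l2 \in S by rewrite !inE.
pose t (j : 'I_3) := nth l [:: l; l1; l2] j.
have tS j : t j \in S by case: j => -[|[|[|]]].
have te j : sweep u (t j) = sweep u l.
  by case: j => -[|[|[|//]]] i; rewrite /t /=; [|apply/eqP|apply/eqP].
rewrite horner_slice; apply: (three_lines_hessian (z := lineZ \o t) (w := lineW \o t)) => /=.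
- by move=> j; apply: size_lineZ.
- by move=> j; apply: size_lineW.
- by move=> j; apply: onS.
- by move=> j; rewrite !horner_lineZ; apply: te.
- by move=> j; rewrite !horner_lineW ?normU //; congr (_ * _ ^+ _); apply: te.
have dz l' : (lineZ l')^`().[u] = - zeta l'.2.
  by rewrite /lineZ derivB derivC derivM derivC mul0r derivX mulr1 !add0r hornerN hornerC.
move=> j j'; rewrite !dz => /oppr_inj e2'.
have e1' : zeta (t j).1 = zeta (t j').1.
  by apply: (addIr (- (u * zeta (t j).2))); rewrite [in RHS]e2' -/(sweep u (t j')) te -(te j).
have /eqP : t j = t j'.
  by rewrite [t j]surjective_pairing [t j']surjective_pairing (zetaI e1') (zetaI e2').
rewrite /t nth_uniq //= => [/eqP/val_inj //|].
by rewrite !inE negb_or eq_sym n1 eq_sym n2 n12.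
Qed.

Let bad := [set l in S | (hessian F).[lineW l, lineZ l] != 0].

Let card_bad : (#|bad| <= 4 * (p * f))%N.
Proof.
have half l : l \in bad -> (size U <= 2 * \sum_(u <- U) (l \in poor u))%N.
  rewrite inE => /andP[lS h0].
  have : (size [seq u <- U | l \notin poor u] < (3 * f).+1)%N.
    apply: leq_trans (max_poly_roots h0 _ (filter_uniq _ uU)) _.
      by apply/allP => u; rewrite mem_filter => /andP[lr uU']; apply/rootP/rich_hessian.
    by apply: size_hessian_line; rewrite ?size_lineZ ?size_lineW.
  rewrite size_filter.
  have -> : (\sum_(u <- U) (l \in poor u) = count (fun u => l \in poor u) U)%N.
    by rewrite -sum1_count [RHS]big_mkcond /=; apply: eq_bigr => u _; case: (l \in _).
  have := count_predC (fun u => l \in poor u) U.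
  rewrite (eq_count (a1 := predC (fun u => l \in poor u)) (a2 := fun u => l \notin poor u)); last by move=> u.
  have arith x y z g : (6 * g <= z -> x + y = z -> y < (3 * g).+1 -> z <= 2 * x)%N by lia.
  exact: arith fU.
have tot : (\sum_(u <- U) #|poor u| <= size U * (2 * (p * f)))%N.
  have -> : (size U * (2 * (p * f)) = \sum_(u <- U) (2 * (p * f)))%N.
    by rewrite big_const_seq count_predT iter_addn_0 mulnC.
  by rewrite big_seq [leqRHS]big_seq; apply: leq_sum => u uU'; apply: card_poor.
rewrite -(leq_pmul2l U_gt0).
apply: (@leq_trans (2 * \sum_(u <- U) #|poor u|)); last by move: tot; lia.
rewrite mulnC -sum_nat_const.
apply: (@leq_trans (\sum_(l in bad) 2 * \sum_(u <- U) (l \in poor u))).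
  exact: leq_sum.
rewrite -big_distrr leq_mul2l /= exchange_big /=; apply: leq_sum => u _.
rewrite -sum1_card [leqRHS]big_mkcond [leqLHS]big_mkcond /=; apply: leq_sum => l _.
by case: (l \in bad); case: (l \in poor u).
Qed.

(* Most lines meet, in many of their points, at least two other lines; there
   the Hessian vanishes, so it vanishes along these lines. They are too many for
   the intersection of F with a surface of degree about three times larger. *)
Let hess : divides F (hessian F).
Proof.
apply: NNPP => nd.
have good l : l \in S :\: bad -> (hessian F).[lineW l, lineZ l] = 0.
  by rewrite !inE => /andP[h lS]; move: h; rewrite lS /= negbK => /eqP.
have := common_lines (subsetDl _ _) nd good.
have [_ hb hc] := boxF.
have h1 : ((size (hessian F)).-1 <= 3 * c)%N.
  by have := size_hessian hc; case: (size _).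
have h2 : ((sizeY (hessian F)).-1 <= 3 * b)%N.
  by have := sizeY_hessian (proj2 (sizeY_le _ _) hb); case: (sizeY _).
have := cardsID bad S; have := subset_leq_card (subsetIr S bad).
move: card_bad many fp h1 h2; rewrite fE.
move: (size (hessian F)).-1 (sizeY (hessian F)).-1 => h k.
have := p_gt0; have := c_gt0.
move=> c0 p0 k1 k2 k3 k4 k5 k6 k7 k8.
have : (h * b + c * k <= 6 * (b * c))%N by nia.
have : (6 * (b * c) <= p * (a + b + c))%N by nia.
rewrite -mulnA in k2; move: k1 k2 k6 k7 k8; clear.
move: (p * _)%N (h * b + _)%N #|S| #|bad| #|S :&: bad| #|S :\: bad| (6 * _)%N; lia.
Qed.

(** A prime surface of weight [f] with more than [20 p f] of the lines would be
    the family of tangent lines of its sections along a smooth line, and such a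
    family contains at most [p] of the lines. *)
Lemma no_rich_component : False.
Proof.
have lW : F^`()`_c.-1 != 0.
  rewrite coef_deriv prednK // -mulr_natr mulf_neq0 //.
    by rewrite -/(lead_coef F) lead_coef_eq0.
  rewrite -!polyC_natr !polyC_eq0 natL_neq0 // c_gt0 fE; lia.
have nd : ~ divides F F^`().
  apply: not_divides_small; last exact: lt_size_deriv.
  by apply: contraNneq lW => e; rewrite e coef0.
have [l0 l0S v10] : exists2 l0, l0 \in S & F^`().[lineW l0, lineZ l0] != 0.
  apply/exists_inP; apply: contraT; rewrite negb_exists_in => /forall_inP h.
  have sing l : l \in S -> F^`().[lineW l, lineZ l] = 0.
    by move/h; rewrite negbK => /eqP.
  have := common_lines (subxx S) nd sing.
  have [_ hb hc] := in_box_deriv boxF.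
  have h2 : ((sizeY F^`()).-1 <= b)%N.
    by have := proj2 (sizeY_le _ _) hb; case: (sizeY _).
  have h1 : ((size F^`()).-1 <= c)%N by move: hc; case: (size _).
  move: many fp h1 h2; rewrite fE; have := p_gt0; have := c_gt0.
  move: (size F^`()).-1 (sizeY F^`()).-1 => h' k c0 p0 k1 k2 k3 k4 k5; exfalso.
  have : (h' * b + c * k <= 2 * (b * c))%N by nia.
  have : (2 * (b * c) <= p * (a + b + c))%N by nia.
  rewrite -mulnA in k1; move: k1 k5; clear.
  move: (p * _)%N (h' * b + _)%N #|S| (2 * _)%N; lia.
have par l : l \in S -> F^`().[lineW l0, lineZ l0] * (lineW l - lineW l0)
    = - (derivZ F).[lineW l0, lineZ l0] * (lineZ l - lineZ l0).
  move=> lS; apply: (inflection_curve_is_line (m := f) pF sF hess) => //.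
  - by rewrite -/b -/c fE; lia.
  - by move=> n hn; rewrite -polyC_natr polyC_eq0 natL_neq0.
  - exact: onS.
  - exact: onS.
have : (#|S| <= p)%N.
  apply: (parallel_lines _ v10 (v2 := - (derivZ F).[lineW l0, lineZ l0])).
    by apply/subsetP => l; rewrite inE => /andP[].
  move=> l l' lS lS'.
  have -> : lineW l - lineW l' = (lineW l - lineW l0) - (lineW l' - lineW l0) by ring.
  have -> : lineZ l - lineZ l' = (lineZ l - lineZ l0) - (lineZ l' - lineZ l0) by ring.
  by rewrite mulrBr !par // -mulrBr.
by move: many; rewrite fE; have := c_gt0; have := p_gt0; nia.
Qed.

End Component.
End ProductLines.

(** The union over [u] in [U] of the sets [A - u B] is the set of points on the
    [p ^ 2] lines above [U]. Were it small, it would lie on a surface of partial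
    degrees at most [p / 61], which would contain the lines and have a component that
    [no_rich_component] excludes. *)
Theorem sweep_lower_bound (L : fieldType) (p : nat) (pL : p \in [pchar L])
    (V : finType) (zeta : V -> L) (A B : {set V}) (U : seq L) (P : L -> seq L) :
  injective zeta -> #|A| = p -> #|B| = p ->
  uniq U -> (forall u, u \in U -> u ^+ p.+1 = 1) -> (p <= 2 * size U)%N ->
  (forall u x y, u \in U -> x \in A -> y \in B -> zeta x - u * zeta y \in P u) ->
  (p ^ 3 <= 61 ^ 3 * \sum_(u <- U) size (P u))%N.
Proof.
move=> zI cA cB uU normU sU cover; rewrite leqNgt; apply/negP => few.
have p0 : (0 < p)%N := prime_gt0 (pcharf_prime pL).
(* 61 > 60 = 20 * 3: a surface with partial degrees at most n has weight at
   most 3 n, and 20 p * 3 n must be less than the number of lines p ^ 2 *)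
pose n := (p %/ 61)%N.
have n1 : (p < 61 * n.+1)%N by rewrite mulnC; apply: ltn_ceil.
have n2 : (61 * n <= p)%N by rewrite mulnC; apply: leq_trunc_div.
pose pts := [seq (u, x, u * x ^+ p) | u <- U, x <- P u].
have spts : (size pts < n.+1 ^ 3)%N.
  rewrite size_allpairs_dep sumnE big_map -(ltn_pmul2l (m := 61 ^ 3)) ?expn_gt0 //.
  by rewrite -expnMn (leq_trans few) // leq_exp2r // ltnW.
have [F0 [F00 boxF F0pts]] := interpolation spts.
have wF0 : (weight F0 <= 3 * n)%N.
  by apply: leq_trans (in_box_weight boxF) _; rewrite !mulSn addn0 addnA.
have onF0 l : l \in setX A B -> F0.[lineW p zeta l, lineZ zeta l] = 0.
  rewrite inE => /andP[lA lB]; apply/eqP; apply: contraT => h0.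
  have : (size U < (n + n + n).+1)%N.
    apply: leq_trans (max_poly_roots h0 _ uU) _.
      apply/allP => u uU'; apply/rootP; rewrite horner_slice horner_lineZ.
      rewrite (horner_lineW pL) ?normU //; apply: F0pts.
      by apply/allpairsPdep; exists u, (zeta l.1 - u * zeta l.2); rewrite uU' cover.
    by apply: in_box_line boxF; [apply: size_lineZ | apply: size_lineW].
  by move: sU n2 p0; lia.
have [|F [pF Fn0 wF many]] := @rich_prime_factor L _ (setX A B) (lineZ zeta) (lineW p zeta) (20 * p) F0 F00 onF0.
  by rewrite cardsX cA cB; nia.
apply: (@no_rich_component L p pL V zeta zI A B _ _ F pF Fn0 U uU normU) => //.
- by rewrite cA.
- by rewrite cB.
- by move: sU p0; lia.
- by move: wF wF0 sU n2; lia.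
- by move: wF wF0 n2; lia.
Qed.

(** * Rotations as elements of norm one *)

Section Rotations.
Variables (p : nat) (pp : prime p) (p3 : p = 3 %[mod 4]).
Notation F := 'F_p.

Let p_odd : p = (4 * (p %/ 4) + 3)%N.
Proof. by rewrite {1}(divn_eq p 4) p3 mulnC. Qed.

Lemma Fp_exp (x : F) : x ^+ p = x.
Proof. by have := expf_card x; rewrite card_Fp. Qed.

Lemma two_neq0 : 2 != 0 :> F.
Proof.
rewrite -(dvdn_pcharf (pchar_Fp pp)); apply/negP => /(dvdn_leq (ltn0Sn 1)).
by move: p_odd; lia.
Qed.

(** By Fermat's theorem, as [(p - 1) / 2] is odd. *)
Lemma no_sqrtN1 (x : F) : x ^+ 2 != -1.
Proof.
apply/eqP => x2; have x0 : x != 0.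
  by apply: contra_eq_neq x2 => ->; rewrite expr0n eq_sym oppr_eq0 oner_eq0.
have : x ^+ (2 * (2 * (p %/ 4) + 1)) = 1.
  apply: (mulIf x0); rewrite -exprSr mul1r -[RHS]Fp_exp; congr (_ ^+ _).
  by rewrite [RHS]p_odd; lia.
rewrite exprM x2 exprD exprM sqrrN !expr1n expr1 mul1r => /eqP.
by rewrite eq_sym -subr_eq0 opprK -[1 + 1]/(2 : F) (negPf two_neq0).
Qed.

Lemma sum_sqr_eq0 (x y : F) : x ^+ 2 + y ^+ 2 = 0 -> x = 0 /\ y = 0.
Proof.
move=> e; have [y0|y0] := eqVneq y 0.
  by move: e; rewrite y0 expr0n addr0 => /eqP; rewrite expf_eq0 => /eqP.
have := no_sqrtN1 (x / y); rewrite exprMn exprVn.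
have -> : x ^+ 2 = - y ^+ 2 by apply/eqP; rewrite -addr_eq0 e.
by rewrite mulNr divff ?eqxx // expf_neq0.
Qed.

Definition rot (c s : F) : 'M[F]_2 :=
  \matrix_(i, j) if i == j then c else if i == 0 then - s else s.

Lemma mulmx_col2 (g : 'M[F]_2) (x : 'cV[F]_2) i :
  (g *m x) i 0 = g i 0 * x 0 0 + g i 1 * x 1 0.
Proof. by rewrite mxE big_ord_recl big_ord1; congr (_ + _ * _); congr (_ _ _); apply: val_inj. Qed.

Lemma det_col2 (g : 'M[F]_2) : \det g = g 0 0 * g 1 1 - g 0 1 * g 1 0.
Proof.
rewrite (expand_det_row _ 0) big_ord_recl big_ord1 /cofactor !det_mx11 !mxE /=.
rewrite expr0 expr1 mul1r mulN1r mulrN.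
by congr (_ * _ - _ * _); congr (_ _ _); apply: val_inj.
Qed.

(** [(g00 - g11) ^ 2 + (g10 + g01) ^ 2] is the sum of the norms of the columns
    minus twice the determinant, hence zero; and the norm is anisotropic. *)
Lemma SO2P (g : 'M[F]_2) : reflect
  [/\ g 1 1 = g 0 0, g 0 1 = - g 1 0 & g 0 0 ^+ 2 + g 1 0 ^+ 2 = 1] (g \in SO2 p).
Proof.
rewrite inE; apply: (iffP andP) => [[/forallP orth /eqP]|[e1 e2 e3]].
  rewrite det_col2 => dt.
  pose v (x y : F) : 'cV[F]_2 := \col_i (if i == 0 then x else y).
  have q x y : (g 0 0 * x + g 0 1 * y) ^+ 2 + (g 1 0 * x + g 1 1 * y) ^+ 2 = x ^+ 2 + y ^+ 2.
    by have /eqP := orth (v x y); rewrite /qnorm !mulmx_col2 !mxE.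
  have q1 := q 1 0; have q2 := q 0 1.
  have : (g 0 0 - g 1 1) ^+ 2 + (g 1 0 + g 0 1) ^+ 2 = 0.
    transitivity ((g 0 0 * 1 + g 0 1 * 0) ^+ 2 + (g 1 0 * 1 + g 1 1 * 0) ^+ 2
      + ((g 0 0 * 0 + g 0 1 * 1) ^+ 2 + (g 1 0 * 0 + g 1 1 * 1) ^+ 2)
      - 2 * (g 0 0 * g 1 1 - g 0 1 * g 1 0)); first by ring.
    by rewrite q1 q2 dt; ring.
  move/sum_sqr_eq0 => [/eqP]; rewrite subr_eq0 => /eqP e1 /eqP.
  rewrite addrC addr_eq0 => /eqP e2; split=> //.
  by move: q1; rewrite !mulr1 !mulr0 !addr0 expr1n expr0n addr0.
split; last by rewrite det_col2 e1 e2 mulNr opprK -!expr2 e3.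
apply/forallP => x; rewrite /qnorm !mulmx_col2 e1 e2; apply/eqP.
rewrite -[RHS]mul1r -e3; ring.
Qed.

Lemma rot_SO2 c s : c ^+ 2 + s ^+ 2 = 1 -> rot c s \in SO2 p.
Proof. by move=> h; apply/SO2P; rewrite !mxE. Qed.

(** Stereographic projection parametrizes all rotations but one. *)
Lemma card_SO2_ge : (p <= #|SO2 p|)%N.
Proof.
pose r (t : F) := rot ((1 - t ^+ 2) / (1 + t ^+ 2)) (2 * t / (1 + t ^+ 2)).
have n0 (t : F) : 1 + t ^+ 2 != 0 by rewrite addrC addr_eq0 no_sqrtN1.
have rI : injective r.
  have back t : (r t) 1 0 / (1 + (r t) 0 0) = t.
    rewrite !mxE /=; field; rewrite n0 /=.
    by rewrite (_ : 1 + t ^+ 2 + (1 - t ^+ 2) = 2) ?two_neq0 //; ring.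
  by move=> t t' e; rewrite -(back t) e back.
rewrite -{1}(card_Fp pp) -(card_imset _ rI); apply/subset_leq_card/subsetP => _ /imsetP[t _ ->].
by apply: rot_SO2; field; apply: n0.
Qed.

Variables (L : fieldType) (emb : {rmorphism F -> L}) (i : L).
Hypothesis i2 : i ^+ 2 = -1.

Lemma embedding_pchar : p \in [pchar L].
Proof. by rewrite (fmorph_pchar emb) pchar_Fp. Qed.

Definition complexify (v : 'cV[F]_2) : L := emb (v 0 0) + i * emb (v 1 0).
Definition rotation_number (g : 'M[F]_2) : L := emb (g 0 0) + i * emb (g 1 0).

Lemma complex_inj (a b a' b' : F) :
  emb a + i * emb b = emb a' + i * emb b' -> a = a' /\ b = b'.
Proof.
move=> e; have : (a - a') ^+ 2 + (b - b') ^+ 2 = 0.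
  apply: (fmorph_inj emb); rewrite rmorph0 rmorphD !rmorphXn !rmorphB /=.
  transitivity ((emb a + i * emb b - (emb a' + i * emb b')) * (emb a - i * emb b - (emb a' - i * emb b'))
     + (1 + i ^+ 2) * (emb b - emb b') ^+ 2); first by ring.
  by rewrite e i2; ring.
by case/sum_sqr_eq0 => /eqP; rewrite subr_eq0 => /eqP -> /eqP; rewrite subr_eq0 => /eqP ->.
Qed.

Lemma complexify_inj : injective complexify.
Proof.
move=> v w /complex_inj[e0 e1]; apply/matrixP => k l; rewrite (ord1 l).
by case: k => -[|[|//]] h; [move: e0 | move: e1]; congr (_ = _); congr (_ _ _); apply: val_inj.
Qed.

Lemma complexifyB v w : complexify (v - w) = complexify v - complexify w.
Proof. by rewrite /complexify !mxE !rmorphB /=; ring. Qed.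

Lemma complexifyM g v : g \in SO2 p ->
  complexify (g *m v) = rotation_number g * complexify v.
Proof.
case/SO2P => e1 e2 _; rewrite /complexify /rotation_number !mulmx_col2 e1 e2.
rewrite !rmorphD !rmorphM /= rmorphN /=.
transitivity ((emb (g 0 0) + i * emb (g 1 0)) * (emb (v 0 0) + i * emb (v 1 0))
   - (1 + i ^+ 2) * (emb (g 1 0) * emb (v 1 0))); first by ring.
by rewrite i2; ring.
Qed.

Lemma rotation_number_inj : {in SO2 p &, injective rotation_number}.
Proof.
move=> g h /SO2P[e1 e2 _] /SO2P[f1 f2 _] /complex_inj[e3 e4].
have E (m : 'M[F]_2) k l : m k l = if (k : nat) == 0%N then (if (l : nat) == 0%N then m 0 0 else m 0 1)
    else (if (l : nat) == 0%N then m 1 0 else m 1 1).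
  by case: k => -[|[|//]] hk; case: l => -[|[|//]] hl /=; congr (_ _ _); apply: val_inj.
by apply/matrixP => k l; rewrite (E g) (E h) e1 e2 f1 f2 e3 e4.
Qed.

(** As [p] is 3 modulo 4, the Frobenius map sends [i] to [- i]: it is complex
    conjugation, and the power [p + 1] is the norm. *)
Lemma rotation_number_norm g : g \in SO2 p -> rotation_number g ^+ p.+1 = 1.
Proof.
case/SO2P => _ _ e3.
have ip : i ^+ p = - i.
  rewrite p_odd exprD exprM (_ : i ^+ 4 = 1) ?expr1n ?mul1r.
    by rewrite exprSr i2 mulN1r.
  by rewrite (exprM _ 2 2) i2 sqrrN expr1n.
rewrite exprSr /rotation_number -(pFrobenius_autE embedding_pchar) rmorphD rmorphM /=.
rewrite !pFrobenius_autE ip -!rmorphXn /= !Fp_exp.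
transitivity (emb (g 0 0 ^+ 2 + g 1 0 ^+ 2) - (1 + i ^+ 2) * emb (g 1 0) ^+ 2).
  by rewrite rmorphD !rmorphXn /=; ring.
by rewrite e3 i2 rmorph1; ring.
Qed.

Lemma card_SO2_le : (#|SO2 p| <= p.+1)%N.
Proof.
have := @max_poly_roots L ('X^(p.+1) - 1%:P) [seq rotation_number g | g <- enum (SO2 p)].
rewrite size_map -cardE size_XnsubC // ltnS; apply.
- by rewrite -size_poly_eq0 size_XnsubC.
- apply/allP => _ /mapP[g gS ->]; rewrite mem_enum in gS.
  by rewrite /root !hornerE rotation_number_norm // subrr.
- rewrite map_inj_in_uniq ?enum_uniq // => g h; rewrite !mem_enum.
  exact: rotation_number_inj.
Qed.

End Rotations.

Lemma exists_imaginary_unit (p : nat) :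
  exists (L : fieldType) (emb : {rmorphism 'F_p -> L}) (i : L), i ^+ 2 = -1.
Proof.
have X0 : 'X^2 + 1 != 0 :> {poly 'F_p} by rewrite -size_poly_eq0 size_XnaddC.
have [L [rs e _]] := FinSplittingFieldFor X0.
exists L, (in_alg L).
have : rs != [::].
  apply/eqP => rs0; move/eqp_size: e; rewrite rs0 big_nil size_poly1.
  by rewrite size_map_poly size_XnaddC.
case: rs e => // i rs e _; exists i.
have : root (map_poly (in_alg L) ('X^2 + 1)) i.
  by rewrite (eqp_root e) root_prod_XsubC inE eqxx.
by rewrite rmorphD rmorph1 /= map_polyXn /root !hornerE addr_eq0 => /eqP.
Qed.

Lemma subset_of_card (T : finType) (A : {set T}) n : (n <= #|A|)%N ->
  exists2 B : {set T}, B \subset A & #|B| = n.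
Proof.
move=> h; exists [set x in take n (enum A)].
  by apply/subsetP => x; rewrite inE => /mem_take; rewrite mem_enum.
by rewrite cardsE (card_uniqP _) ?take_uniq ?enum_uniq // size_takel // -cardE.
Qed.

Theorem theorem5p2 (R : realType) :
  exists c C : R, 0 < c /\ 0 < C /\
    forall (p : nat) (A B : {set 'cV['F_p]_2}),
      prime p -> p = 3 %[mod 4] ->
      (p <= #|A|)%N -> (p <= #|B|)%N ->
      for_almost_every c (fun g : 'M['F_p]_2 =>
        p%:R ^+ 2 <=
          C * #|[set z : 'cV['F_p]_2 | (1 <= #|A :&: rigid_image g z B|)%N]|%:R).
Proof.
exists (2%:R^-1), (2 * 61 ^+ 3)%:R; split; first by rewrite invr_gt0 ltr0n.
split; first by rewrite ltr0n muln_gt0.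
move=> p A B pp p3 cA cB; rewrite /for_almost_every.
pose Z (g : 'M['F_p]_2) := [set z : 'cV['F_p]_2 | (1 <= #|A :&: rigid_image g z B|)%N].
have -> : [set g in SO2 p | p%:R ^+ 2 <= (2 * 61 ^+ 3)%:R * #|Z g|%:R :> R] =
  [set g in SO2 p | (p ^ 2 <= 2 * 61 ^ 3 * #|Z g|)%N].
  by apply/setP => g; rewrite !inE -natrX -natrM ler_nat.
set good := [set g in SO2 p | _].
(* otherwise at least half of the rotations are bad, which gives at least p / 2
   and at most p + 1 sets Z g, of size less than p ^ 2 / C: too few points for
   the lower bound p ^ 3 / 61 ^ 3 *)
rewrite mulrC ler_pdivrMr ?ltr0n // -natrM ler_nat leqNgt; apply/negP => few.
have [L [emb [i i2]]] := exists_imaginary_unit p.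
pose bad := SO2 p :\: good.
have badS g : g \in bad -> g \in SO2 p by rewrite inE => /andP[].
have cbad : (#|bad| + #|good| = #|SO2 p|)%N.
  have /setIidPr gS : good \subset SO2 p by apply/subsetP => g; rewrite inE => /andP[].
  by rewrite addnC -(cardsID good (SO2 p)) gS.
pose num := rotation_number emb i.
have numI : {in SO2 p &, injective num} by apply: rotation_number_inj.
have [A0 A0A cA0] := subset_of_card cA; have [B0 B0B cB0] := subset_of_card cB.
pose P u := if [pick g in SO2 p | num g == u] is Some g
  then [seq complexify emb i z | z <- enum (Z g)] else [::].
have Pnum g : g \in SO2 p -> P (num g) = [seq complexify emb i z | z <- enum (Z g)].
  move=> gS; rewrite /P; case: pickP => [h /andP[hS /eqP /numI -> //]|].
  by move/(_ g); rewrite gS eqxx.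
have p_gt0 := prime_gt0 pp.
have lowS := card_SO2_ge pp p3; have highS := card_SO2_le pp p3 emb i2.
pose U := [seq num g | g <- enum bad].
have uU : uniq U.
  rewrite map_inj_in_uniq ?enum_uniq // => g h; rewrite !mem_enum.
  by move=> /badS gS /badS hS; apply: numI.
have sU : size U = #|bad| by rewrite size_map -cardE.
have normU u : u \in U -> u ^+ p.+1 = 1.
  by case/mapP => g; rewrite mem_enum => /badS gS ->; apply: rotation_number_norm.
have cover u x y : u \in U -> x \in A0 -> y \in B0 ->
    complexify emb i x - u * complexify emb i y \in P u.
  case/mapP => g; rewrite mem_enum => /badS gS -> xA yB.
  rewrite Pnum // -(complexifyM pp p3 emb i2) // -complexifyB; apply: map_f.
  rewrite mem_enum inE; apply/card_gt0P; exists x; rewrite inE (subsetP A0A) //=.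
  by apply/imsetP; exists y; rewrite ?(subsetP B0B) // addrC subrK.
have sU2 : (p <= 2 * size U)%N by rewrite sU; lia.
have := sweep_lower_bound (embedding_pchar pp emb) (complexify_inj pp p3 i2) cA0 cB0 uU normU sU2 cover.
have -> : (\sum_(u <- U) size (P u) = \sum_(g in bad) #|Z g|)%N.
  rewrite big_map big_enum /=; apply: eq_bigr => g /badS gS.
  by rewrite Pnum // size_map -cardE.
have : (2 * (61 ^ 3 * \sum_(g in bad) #|Z g|) <= #|bad| * (p ^ 2).-1)%N.
  rewrite mulnA big_distrr /= -sum_nat_const; apply: leq_sum => g.
  rewrite inE => /andP[gb gS]; rewrite inE gS /= -ltnNge in gb.
  by rewrite -ltnS prednK // expn_gt0 p_gt0.
have : (#|bad| * (p ^ 2).-1 < 2 * p ^ 3)%N.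
  have h : (#|bad| <= 2 * p)%N by lia.
  apply: (@leq_ltn_trans (2 * p * (p ^ 2).-1)); first by rewrite leq_mul2r h orbT.
  have p2 : (0 < p ^ 2)%N by rewrite expn_gt0 p_gt0.
  by rewrite (expnS p 2) mulnA ltn_pmul2l ?muln_gt0 ?p_gt0 // prednK.
move: (61 ^ 3 * _)%N (#|bad| * _)%N (p ^ 3)%N => x y z h1 h2 h3; lia.
Qed.
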